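(* Let $u_0$ be a given $2L$-periodic function and let $u$ be the solution, $2L$-periodic in $x$, of $$\partial_t u+\partial_x\Big(\frac{u^2}{2}-\partial_x u+\mathcal{J}[u]\Big)=0 \quad (x\in\mathbf{R},\ t\in(0,T)),\qquad u(0,\cdot)=u_0 .$$ Suppose $u$ is sufficiently smooth. For each $h$, let $u_h^0\in\mathcal{S}_h^r$ satisfy $\|u_h^0-u_0\|\le C_0h^{r-1}$ with $C_0$ independent of $h$. Then there exist $\delta>0$ and a positive constant $C=C(u)$, independent of $h$ and $\Delta t$, such that, whenever $\Delta t=T/N<\delta$ and $U^0,\dots,U^N\in\mathcal{S}_h^r$ satisfy $U^0=u_h^0$ and, for all $n=0,\dots,N-1$ and all $\chi\in\mathcal{S}_h^r$, $$(\partial U^n,\chi)+(U^{n+1/2}U_x^{n+1/2},\chi)+(U_x^{n+1/2},\chi')-(\mathcal{J}[U^{n+1/2}],\chi')=0,$$ one has $$\max_{0\le n\le N}\|u(t^n,\cdot)-U^n\|\le C\,(\Delta t^2+h^{r-1}).$$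
   Context: Fix $L>0$, $T>0$. All functions are real-valued. For real $s\ge 0$, $H^s_{per}$ is the Sobolev space of $2L$-periodic functions on $\mathbf{R}$ of order $s$ (elements of $H^s_{loc}(\mathbf{R})$ that are $2L$-periodic), with norm $\|\cdot\|_s$ over one period; $\|\cdot\|$ and $(\cdot,\cdot)$ are the norm and inner product of $L^2(-L,L)$. Subscript $x$ and prime denote spatial derivatives. Nonlocal operator (with the integral truncated to $(0,L)$): $\mathcal{J}[\varphi](x)=\int_0^{L}|\xi|^{-1/3}\varphi'(x-\xi)\,d\xi$. Finite element spaces: $r\ge 2$ is an integer. For a partition $-L=x_0<x_1<\dots<x_M=L$ with $h=\max_j(x_{j+1}-x_j)$, $\mathcal{S}_h^r$ is a finite-dimensional subspace of $H^1_{per}$ consisting of continuously differentiable $2L$-periodic piecewise polynomial functions of degree $r-1$. The family $(\mathcal{S}_h^r)$ is assumed to satisfy, for small $h$, $\inf_{\chi\in\mathcal{S}_h^r}\{\|v-\chi\|+h\|(v-\chi)'\|\}\le C h^s\|v\|_s$ for all $v\in H^s_{per}$, $1\le s\le r$, with $C$ independent of $h$ and $v$. Time grid: $N\in\mathbf{N}$, $\Delta t=T/N$, $t^n=n\Delta t$, $\partial U^n=(U^{n+1}-U^n)/\Delta t$, $U^{n+1/2}=(U^n+U^{n+1})/2$. ''Sufficiently smooth'' means: there is an integer $m$ depending only on $r$ such that the conclusion holds whenever $u\in C^m([0,T]\times\mathbf{R})$. *)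

(* Defs.v *)
From HB Require Import structures.
From mathcomp Require Import all_boot all_order all_algebra.
From mathcomp Require Import all_classical all_reals all_analysis.

Set Implicit Arguments.
Unset Strict Implicit.
Unset Printing Implicit Defensive.

Import Order.TTheory GRing.Theory Num.Theory.
Import numFieldNormedType.Exports.

Local Open Scope classical_set_scope.
Local Open Scope ring_scope.

Section Defs.
Variable R : realType.
Implicit Types (L T a s sigma : R) (f g v w : R -> R).

Local Notation leb := (@lebesgue_measure R).

Definition per2L L f : Prop := forall x, f (x + 2 * L) = f x.

Definition inner L f g : R := \int[leb]_(x in `[(- L), L]) (f x * g x).

Definition L2norm L f : R := Num.sqrt (inner L f f).

Definition nonlocalJ L f (x : R) : R :=
  \int[leb]_(xi in `[0, L]) (`|xi| `^ (- 3^-1) * derive1 f (x - xi)).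

(* Sobolev spaces of real order.  Derivatives are weak derivatives on the line;
   the fractional part of the order is measured by the Sobolev-Slobodeckij
   (Gagliardo) double integral. *)

Definition test_function (phi : R -> R) : Prop :=
  (forall n x, derivable (derive1n n phi) x 1) /\
  (exists a, forall x, a < `|x| -> phi x = 0).

Definition L2loc f : Prop :=
  measurable_fun [set: R] f /\
  forall a, (\int[leb]_(x in `[(- a)%R, a]) ((f x) ^+ 2)%:E < +oo)%E.

Definition weak_derivative f g : Prop :=
  forall phi, test_function phi ->
    \int[leb]_(x in [set: R]) (f x * derive1 phi x) =
    - \int[leb]_(x in [set: R]) (g x * phi x).

Definition gagliardo sigma (A : set R) (B : R -> set R) f : \bar R :=
  (\int[leb]_(x in A) \int[leb]_(y in B x)
     (`|f x - f y| ^+ 2 / `|x - y| `^ (1 + 2 * sigma))%:E)%E.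

(* The function v is in H^s_loc, with weak derivatives D 0 = v, D 1, ...,
   D (floor s).  These are unique up to null sets; the values D j with
   j > floor s are irrelevant. *)
Definition Hs_loc s v (D : nat -> R -> R) : Prop :=
  let m := Num.truncn s in
  [/\ D 0%N = v,
      forall j, (j <= m)%N -> L2loc (D j),
      forall j, (j < m)%N -> weak_derivative (D j) (D j.+1) &
      m%:R != s -> forall a,
        (gagliardo (s - m%:R) `[(- a)%R, a]%classic
           (fun=> `[(- a)%R, a]%classic) (D m) < +oo)%E].

Definition Hs_per L s v (D : nat -> R -> R) : Prop :=
  per2L L v /\ Hs_loc s v D.

(* The norm over one period of the function with weak derivatives D.  In the
   fractional part x runs over one period and y over the period centred at x,
   so that the norm is invariant under translation. *)
Definition Hs_norm L s (D : nat -> R -> R) : R :=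
  let m := Num.truncn s in
  Num.sqrt (\sum_(j < m.+1) L2norm L (D j) ^+ 2 +
    if m%:R == s then 0
    else fine (gagliardo (s - m%:R) `[(- L)%R, L]%classic
                 (fun x => `[(x - L)%R, (x + L)%R]%classic) (D m))).

(* [nodes] is -L = x_0 < ... < x_M = L, with M = [cells]. *)
Definition partition_of L (cells : nat) (nodes : nat -> R) : Prop :=
  [/\ nodes 0%N = - L, nodes cells = L &
      forall j, (j < cells)%N -> nodes j < nodes j.+1].

(* Continuously differentiable 2L-periodic functions that are polynomials of
   degree at most r - 1 on each cell of the partition. *)
Definition C1_per_pp L (r cells : nat) (nodes : nat -> R) v : Prop :=
  [/\ per2L L v,
      (forall x, derivable v x 1), continuous (derive1 v) &
      forall j, (j < cells)%N -> exists2 p : {poly R}, (size p <= r)%N &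
        forall x, nodes j <= x <= nodes j.+1 -> v x = p.[x]].

(* A finite-dimensional space is given by a finite spanning family. *)
Record fe_space L (r : nat) := FESpace {
  fe_cells : nat;
  fe_nodes : nat -> R;
  fe_partition : partition_of L fe_cells fe_nodes;
  fe_dim : nat;
  fe_gen : 'I_fe_dim -> R -> R;
  fe_gen_pp : forall k, C1_per_pp L r fe_cells fe_nodes (fe_gen k)
}.

Definition fe_set L r (S : fe_space L r) : set (R -> R) :=
  [set v | exists c : 'I_(fe_dim S) -> R,
             v = fun x => \sum_k c k * fe_gen k x].

Definition mesh L r (S : fe_space L r) : R :=
  \big[Num.max/0]_(j < fe_cells S) (fe_nodes S j.+1 - fe_nodes S j).

(* The constant may depend on s, but not on the space or on v; since s >= 1,
   D 1 is the derivative v'. *)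
Definition approximation_property L r (I : Type) (S : I -> fe_space L r) :
    Prop :=
  forall s, 1 <= s <= r%:R ->
  exists h0 C : R, [/\ 0 < h0, 0 < C &
    forall i, mesh (S i) <= h0 -> forall v D, Hs_per L s v D ->
      inf [set e | exists2 chi, fe_set (S i) chi &
             e = L2norm L (v \- chi) +
                 mesh (S i) * L2norm L (D 1%N \- derive1 chi)]
        <= C * mesh (S i) `^ s * Hs_norm L s D].

(* Here u is of class C^m on [0,T] x R: [D i j] is the mixed derivative
   of order i in t and j in x, continuous up to t = 0 and t = T. *)
Definition smooth_strip (m : nat) T (u : R -> R -> R) : Prop :=
  exists D : nat -> nat -> R -> R -> R,
  [/\ forall t x : R, 0 <= t <= T -> D 0%N 0%N t x = u t x,
      forall i j, (i + j <= m)%N ->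
        {within [set p : R * R | 0 <= p.1 <= T],
           continuous (fun p : R * R => D i j p.1 p.2)},
      forall i j, (i + j < m)%N -> forall t x : R, 0 < t < T ->
        is_derive t 1 (fun t' => D i j t' x) (D i.+1 j t x) &
      forall i j, (i + j < m)%N -> forall t x : R, 0 <= t <= T ->
        is_derive x 1 (D i j t) (D i j.+1 t x)].

Definition periodic_solution L T (u0 : R -> R) (u : R -> R -> R) : Prop :=
  [/\ forall t : R, 0 <= t <= T -> per2L L (u t),
      forall t x : R, 0 < t < T ->
        derive1 (fun t' => u t' x) t +
        derive1 (fun y =>
          u t y ^+ 2 / 2 - derive1 (u t) y + nonlocalJ L (u t) y) x
        = 0 &
      u 0 = u0].

Definition midpoint (U : nat -> R -> R) (n : nat) : R -> R :=
  fun x => (U n x + U n.+1 x) / 2.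

Definition diffquot (dt : R) (U : nat -> R -> R) (n : nat) : R -> R :=
  fun x => (U n.+1 x - U n x) / dt.

Definition crank_nicolson L r (S : fe_space L r) (dt : R) (N : nat)
    (U : nat -> R -> R) : Prop :=
  forall n, (n < N)%N -> forall chi, fe_set S chi ->
    let V := midpoint U n in
    inner L (diffquot dt U n) chi + inner L (V \* derive1 V) chi
    + inner L (derive1 V) (derive1 chi)
    - inner L (nonlocalJ L V) (derive1 chi) = 0.

End Defs.

(* Main.v *)
(* Let W^n be the H^1-orthogonal projection of u(t^n) onto the finite element space and
   theta^n = U^n - W^n.  The approximation property makes W^n - u(t^n) of order h^(r-1) in
   H^1; as the projection is linear, the same holds for the difference quotients in time.
   Taylor expansion around t^(n+1/2) makes the remaining consistency errors of order dt^2.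
   Testing the equation of theta with the mean th of theta^n and theta^(n+1), the term
   (th^2, th') vanishes by periodicity, the other nonlinear terms only need sup bounds on
   u and W^n, which Sobolev's inequality and the contractivity of the projection give
   without inverse inequalities, and the nonlocal term obeys the Garding-type bound
   |(J[v], v')| <= e |v'|^2 + C_e |v|^2, as the kernel is integrable at 0 and smooth away
   from it.  The discrete Gronwall inequality concludes.  Only L^2 products of continuous
   functions occur, and they are estimated through their squares. *)
Require Import Defs.
From HB Require Import structures.
From mathcomp Require Import all_boot all_order all_algebra.
From mathcomp Require Import all_classical all_reals all_analysis.
From mathcomp Require Import measurable_realfun ring lra.
Import Order.TTheory GRing.Theory Num.Theory.
Import numFieldNormedType.Exports.
Local Open Scope classical_set_scope.
Local Open Scope ring_scope.

Set Implicit Arguments.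
Unset Strict Implicit.
Unset Printing Implicit Defensive.

(** * Continuous functions and integrals *)

Section Continuity.
Variable R : realType.
Implicit Types (f g : R -> R).

(** The comparison is made at the midpoint time: with [eta] the mean of W^n and W^(n+1) minus
    u(t^(n+1/2)), the midpoint value of the scheme is [th + eta + u]. Projection error and time
    averaging error thus enter together through [eta], and the nonlinear flux is never expanded in
    time. Equation and scheme are both brought to the form (time derivative, chi) = (flux, chi'), so
    that they can be subtracted for the same test function. In this form the derivative of [eta] is
    paired with that of [th], which is where the rate h^(r-1) comes from; every factor th' is paid
    for by the diffusion. The restriction on the time step serves to absorb the new value on the
    right of the error recursion and does not involve h. The constants must hold on every mesh,
    whereas the approximation property speaks of fine meshes only; the gap is closed inside the
    projection estimate. *)

Lemma ctsD f g : continuous f -> continuous g -> continuous (fun x => f x + g x).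
Proof. by move=> cf cg x; apply: cvgD; [exact: cf|exact: cg]. Qed.

Lemma ctsN f : continuous f -> continuous (fun x => - f x).
Proof. by move=> cf x; apply: cvgN; exact: cf. Qed.

Lemma ctsM f g : continuous f -> continuous g -> continuous (fun x => f x * g x).
Proof. by move=> cf cg x; apply: cvgM; [exact: cf|exact: cg]. Qed.

Lemma ctsX f n : continuous f -> continuous (fun x => f x ^+ n).
Proof.
move=> cf; elim: n => [|n IH] x.
  under eq_fun do rewrite expr0.
  exact: cvg_cst.
under eq_fun do rewrite exprS.
by apply: cvgM; [exact: cf|exact: IH].
Qed.

Lemma cts_cst (c : R) : continuous (fun _ : R => c).
Proof. by move=> x; exact: cvg_cst. Qed.

Lemma cts_comp f g : continuous f -> continuous g -> continuous (fun x => f (g x)).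
Proof. by move=> cf cg x; apply: continuous_comp; [exact: cg|exact: cf]. Qed.

Lemma cts_norm f : continuous f -> continuous (fun x => `|f x|).
Proof. by move=> cf x; apply: cvg_norm; exact: cf. Qed.

Lemma cts_id : continuous (fun x : R => x).
Proof. by move=> x; exact: cvg_id. Qed.

Lemma cts_derive f (df : R -> R) : (forall x : R, is_derive x 1 f (df x)) -> continuous f.
Proof.
move=> h x; apply/differentiable_continuous/derivable1_diffP.
by have := h x => -[].
Qed.

Lemma cts_integrable f (a b : R) : continuous f ->
  (@lebesgue_measure R).-integrable `[a, b] (EFin \o f).
Proof.
move=> cf; apply: continuous_compact_integrable; first exact: segment_compact.
exact: continuous_subspaceT.
Qed.

Lemma cts_bounded f (a b : R) : continuous f ->
  exists2 M, 0 < M & forall x : R, a <= x <= b -> `|f x| <= M.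
Proof.
move=> cf.
have := @compact_bounded _ _ (f @` `[a, b]).
have cK : compact (f @` `[a, b]).
  apply: continuous_compact; last exact: segment_compact.
  exact: continuous_subspaceT.
move=> /(_ cK) [M [Mr hM]].
exists (`|M| + 1); first by rewrite ltr_pwDr.
move=> x xab; apply: (hM (`|M| + 1)) => /=.
  by rewrite (le_lt_trans (ler_norm M)) // ltrDl.
by exists x => //=; rewrite in_itv.
Qed.

End Continuity.

(** * Integrals over segments and primitives on the line *)

Section Integral.
Variable R : realType.
Implicit Types (f g : R -> R) (a b : R).
Local Notation leb := (@lebesgue_measure R).
Local Notation int a b f := (\int[leb]_(x in `[a, b]) f x).

Lemma intD a b f g : continuous f -> continuous g ->
  int a b (fun x => f x + g x) = int a b f + int a b g.
Proof. by move=> cf cg; apply: RintegralD => //; exact: cts_integrable. Qed.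

Lemma intZ a b c f : continuous f ->
  int a b (fun x => c * f x) = c * int a b f.
Proof. by move=> cf; apply: RintegralZl => //; exact: cts_integrable. Qed.

Lemma le_int a b f g : continuous f -> continuous g ->
  (forall x : R, a <= x <= b -> f x <= g x) -> int a b f <= int a b g.
Proof.
move=> cf cg fg; apply: le_Rintegral => //; try exact: cts_integrable.
Qed.

Lemma int_cst a b c : a <= b -> int a b (fun=> c) = c * (b - a).
Proof.
move=> ab; rewrite Rintegral_cst//= lebesgue_measure_itv/= lte_fin.
case: ifP => [_|/negbT]; first by rewrite -EFinD.
by rewrite -leNgt => ba; rewrite (_ : b = a) ?subrr //; apply/eqP; rewrite eq_le ba.
Qed.

Lemma FTC a b F f : a <= b -> (forall x : R, is_derive x 1 F (f x)) -> continuous f ->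
  int a b f = F b - F a.
Proof.
rewrite le_eqVlt => /predU1P[-> _ _|ab dF cf].
  by rewrite set_itv1 Rintegral_set1 subrr.
have cF := cts_derive dF.
rewrite /Rintegral (@continuous_FTC2 _ f F) //.
- exact: continuous_subspaceT.
- split => [x _||]; first by have := dF x => -[].
  + by apply: cvg_at_right_filter; exact: cF.
  + by apply: cvg_at_left_filter; exact: cF.
- by move=> x _; rewrite derive1E; have := dF x => -[].
Qed.

(** Both integrals in [F] start to the left of 0 and of [x], so that the sign of [x] requires no
    case distinction. By [FE] the starting point is irrelevant; near a given [x] it can be frozen at
    [- A], where the fundamental theorem applies. *)
Lemma primitive f : continuous f -> exists F, forall x : R, is_derive x 1 F (f x).
Proof.
move=> cf.
pose F x := \int[leb]_(t in `[- (`|x| + 1), x]) f t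
          - \int[leb]_(t in `[- (`|x| + 1), 0]) f t.
have FE A x : `|x| < A -> F x = int (- A) x f - int (- A) 0 f.
  move=> xA; rewrite /F.
  have split_int c y : 0 < c -> - c < y -> forall c', c <= c' ->
     int (- c') y f = int (- c') (- c) f + int (- c) y f.
    move=> c0 cy c' cc'.
    have h := @Rintegral_itvB R f (BLeft (- c')) (BRight y) (- c).
    have h1 : int (- c') y f - int (- c') (- c) f =
              \int[leb]_(t in `]- c, y]) f t.
      apply: h; [exact: cts_integrable|by rewrite bnd_simp lerN2|].
      by rewrite bnd_simp ltW.
    rewrite Rintegral_itv_obnd_cbnd in h1; last first.
      apply: integrableS (@cts_integrable _ f (- c) y cf) => //.
      exact: subset_itv_oc_cc.
    by rewrite -h1; ring.
  wlog: A xA / `|x| + 1 <= A.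
    move=> H; have [?|/ltW lA] := leP (`|x| + 1) A; first exact: H.
    have A0 : 0 < A by apply: le_lt_trans xA.
    have xA' : - A < x by move: xA; rewrite ltr_norml => /andP[].
    rewrite (split_int A x A0 xA' _ lA) (split_int A 0 A0 _ _ lA); last by rewrite oppr_lt0.
    ring.
  move=> lA; have x0 : 0 < `|x| + 1 by rewrite ltr_wpDl.
  have xA' : - (`|x| + 1) < x.
    have : `|x| < `|x| + 1 by rewrite ltrDl.
    by rewrite ltr_norml => /andP[].
  rewrite (split_int _ _ x0 xA' _ lA) (split_int _ 0 x0 _ _ lA); last by rewrite oppr_lt0.
  ring.
exists F => x.
pose A := `|x| + 1.
have xA : `|x| < A by rewrite ltrDl.
have := xA; rewrite ltr_norml => /andP[xA1 xA2].
have [d1 d2] := @continuous_FTC1_closed _ f (- A) x A xA2 (@cts_integrable _ _ _ _ cf) xA1 (cf x).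
have dG : is_derive x 1 (fun y => int (- A) y f - int (- A) 0 f) (f x).
  have dd : is_derive x 1 (fun y => int (- A) y f) (f x).
    by split; [exact: d1|rewrite -derive1E; exact: d2].
  have := @is_deriveB _ _ _ _ (cst (int (- A) 0 f)) x 1 _ _ dd (is_derive_cst _ _ _).
  by rewrite subr0.
apply: near_eq_is_derive dG.
have : \forall y \near x, `|y| < A.
  exists 1 => //= y /= xy; rewrite -(subrK x y) addrC /A.
  by rewrite (le_lt_trans (ler_normD _ _)) // ltrD2l distrC.
apply: filterS => y yA; exact/esym/FE.
Qed.

End Integral.

(** * Periodic functions of class C^1 *)

Section C1per.
Variable R : realType.
Variable L : R.
Implicit Types (f g : R -> R).

Definition C1per f : Prop :=
  [/\ per2L L f, forall x, derivable f x 1 & continuous (derive1 f)].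

Lemma is_derive1 f (x : R) : derivable f x 1 -> is_derive x 1 f (derive1 f x).
Proof. by move=> df; split => //; rewrite derive1E. Qed.

Lemma derive1_val f (x d : R) : is_derive x 1 f d -> derive1 f x = d.
Proof. by move=> [_ <-]; rewrite derive1E. Qed.

Lemma derive1_fun f (df : R -> R) : (forall x : R, is_derive x 1 f (df x)) ->
  derive1 f = df.
Proof. by move=> h; apply/funext => x; exact: derive1_val. Qed.

Lemma is_deriveDf f g (x a b : R) : is_derive x 1 f a -> is_derive x 1 g b ->
  is_derive x 1 (fun y => f y + g y) (a + b).
Proof. by move=> *; exact: is_deriveD. Qed.

Lemma is_deriveBf f g (x a b : R) : is_derive x 1 f a -> is_derive x 1 g b ->
  is_derive x 1 (fun y => f y - g y) (a - b).
Proof. by move=> *; exact: is_deriveB. Qed.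

Lemma is_deriveMf f g (x a b : R) : is_derive x 1 f a -> is_derive x 1 g b ->
  is_derive x 1 (fun y => f y * g y) (f x * b + g x * a).
Proof. by move=> *; exact: is_deriveM. Qed.

Lemma is_deriveZf f (x c a : R) : is_derive x 1 f a ->
  is_derive x 1 (fun y => c * f y) (c * a).
Proof. by move=> *; exact: is_deriveZ. Qed.

Lemma is_derive_comp_shift f (x c a : R) : is_derive (x + c) 1 f a ->
  is_derive x 1 (fun y => f (y + c)) a.
Proof.
move=> df; have h := is_deriveD (is_derive_id x 1) (is_derive_cst c x 1).
have := @is_derive1_comp _ f (fun y => y + c) x _ _ df h.
by rewrite addr0 mulr1.
Qed.

Lemma per2L_derive f (df : R -> R) : per2L L f ->
  (forall x : R, is_derive x 1 f (df x)) -> per2L L df.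
Proof.
move=> pf h x.
have h1 := is_derive_comp_shift (h (x + 2 * L)).
have -> : df (x + 2 * L) = derive1 (fun y => f (y + 2 * L)) x.
  by rewrite (derive1_val h1).
by rewrite (_ : (fun y => _) = f) ?(derive1_val (h x)) //; apply/funext.
Qed.

Lemma C1per_derive f (x : R) : C1per f -> is_derive x 1 f (derive1 f x).
Proof. by case=> _ df _; exact: is_derive1. Qed.

Lemma C1perI f (df : R -> R) : per2L L f ->
  (forall x : R, is_derive x 1 f (df x)) -> continuous df -> C1per f.
Proof.
move=> pf h c; split => //; last by rewrite (derive1_fun h).
Qed.

Lemma C1per_cts f : C1per f -> continuous f.
Proof. by move=> cf; apply: cts_derive => x; exact: C1per_derive. Qed.

Lemma C1per_dcts f : C1per f -> continuous (derive1 f).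
Proof. by case. Qed.

Lemma C1per_per f : C1per f -> per2L L f.
Proof. by case. Qed.

Lemma C1per_dper f : C1per f -> per2L L (derive1 f).
Proof. by move=> cf; apply: (per2L_derive (C1per_per cf)) => x; exact: C1per_derive. Qed.

Lemma derive1D_fun f g : C1per f -> C1per g ->
  derive1 (fun x => f x + g x) = fun x => derive1 f x + derive1 g x.
Proof.
by move=> cf cg; apply: derive1_fun => x; apply: is_deriveDf; exact: C1per_derive.
Qed.

Lemma derive1B_fun f g : C1per f -> C1per g ->
  derive1 (fun x => f x - g x) = fun x => derive1 f x - derive1 g x.
Proof.
by move=> cf cg; apply: derive1_fun => x; apply: is_deriveBf; exact: C1per_derive.
Qed.

Lemma derive1Z_fun c f : C1per f ->
  derive1 (fun x => c * f x) = fun x => c * derive1 f x.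
Proof.
by move=> cf; apply: derive1_fun => x; apply: is_deriveZf; exact: C1per_derive.
Qed.

Lemma C1perD f g : C1per f -> C1per g -> C1per (fun x => f x + g x).
Proof.
move=> cf cg; apply: (@C1perI _ (fun x => derive1 f x + derive1 g x)).
- by move=> x; rewrite (C1per_per cf) (C1per_per cg).
- by move=> x; apply: is_deriveDf; exact: C1per_derive.
- by apply: ctsD; exact: C1per_dcts.
Qed.

Lemma C1perZ c f : C1per f -> C1per (fun x => c * f x).
Proof.
move=> cf; apply: (@C1perI _ (fun x => c * derive1 f x)).
- by move=> x; rewrite (C1per_per cf).
- by move=> x; apply: is_deriveZf; exact: C1per_derive.
- by apply: ctsM; [exact: cts_cst|exact: C1per_dcts].
Qed.

Lemma C1per_ext f g : f =1 g -> C1per f -> C1per g.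
Proof. by move=> /funext ->. Qed.

Lemma C1perB f g : C1per f -> C1per g -> C1per (fun x => f x - g x).
Proof.
move=> cf cg; apply: (@C1per_ext (fun x => f x + (-1) * g x)) => [x|].
  by rewrite mulN1r.
by apply: C1perD => //; exact: C1perZ.
Qed.

Lemma C1per0 : C1per (fun=> 0).
Proof.
apply: (@C1perI _ (fun=> 0)) => //; exact: cts_cst.
Qed.

Lemma C1per_sum n (F : 'I_n -> R -> R) (c : 'I_n -> R) :
  (forall k, C1per (F k)) -> C1per (fun x => \sum_k c k * F k x).
Proof.
elim: n F c => [|n IH] F c h.
  by apply: (C1per_ext _ C1per0) => x; rewrite big_ord0.
pose A x := \sum_(k < n) c (widen_ord (leqnSn n) k) * F (widen_ord (leqnSn n) k) x.
apply: (@C1per_ext (fun x => A x + c ord_max * F ord_max x)).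
  by move=> x; rewrite big_ord_recr.
by apply: C1perD; [apply: IH|exact: C1perZ].
Qed.

End C1per.

(** * Automation for continuity goals *)

Ltac cts_hyp f :=
  match goal with
  | H : forall x, continuous_at x f |- _ => exact H
  | H : C1per _ f |- _ => exact (C1per_cts H)
  end.

Ltac cts1 :=
  lazymatch goal with
  | |- forall x, continuous_at x ?h => first
    [ cts_hyp h
    | lazymatch h with
      | (fun _ => ?c) => exact: cts_cst
      | (fun y => y) => exact: cts_id
      | (fun y => @GRing.opp _ (@?f y)) => apply: (@ctsN _ f)
      | (fun y => @GRing.add _ (@?f y) (@?g y)) => apply: (@ctsD _ f g)
      | (fun y => @GRing.mul _ (@?f y) (@?g y)) => apply: (@ctsM _ f g)
      | (fun y => @GRing.exp _ (@?f y) ?n) => apply: (@ctsX _ f n)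
      | (fun y => @Num.norm _ _ (@?f y)) => apply: (@cts_norm _ f)
      | (fun y => derive1 ?f y) => match goal with H : C1per _ f |- _ => exact (C1per_dcts H) end
      | derive1 ?f => match goal with H : C1per _ f |- _ => exact (C1per_dcts H) end
      | (fun y => ?f y) => cts_hyp f
      end
    | assumption ]
  end.
Ltac cts := try solve [repeat cts1].

(** * The L^2 inner product *)

Section Inner.
Variable R : realType.
Variable L : R.
Hypothesis L0 : 0 < L.
Implicit Types (f g h : R -> R).
Local Notation leb := (@lebesgue_measure R).
Local Notation int a b f := (\int[leb]_(x in `[a, b]) f x).
Local Notation I := (inner L).
Local Notation Q f := (inner L f f).

Let LL : - L <= L. Proof. by rewrite ge0_cp // ltW. Qed.

Lemma innerC f g : I f g = I g f.
Proof. by rewrite /inner; under eq_Rintegral do rewrite mulrC. Qed.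

Lemma innerDl f g h : continuous f -> continuous g -> continuous h ->
  I (fun x => f x + g x) h = I f h + I g h.
Proof.
move=> cf cg ch; rewrite /inner; under eq_Rintegral do rewrite mulrDl.
by rewrite intD //; cts.
Qed.

Lemma innerZl c f h : continuous f -> continuous h ->
  I (fun x => c * f x) h = c * I f h.
Proof.
move=> cf ch; rewrite /inner; under eq_Rintegral do rewrite -mulrA.
by rewrite intZ //; cts.
Qed.

Lemma innerNl f h : continuous f -> continuous h ->
  I (fun x => - f x) h = - I f h.
Proof.
move=> cf ch; rewrite -mulN1r -innerZl //; congr inner.
by apply/funext => x; rewrite mulN1r.
Qed.

Lemma innerBl f g h : continuous f -> continuous g -> continuous h ->
  I (fun x => f x - g x) h = I f h - I g h.
Proof.
by move=> cf cg ch; rewrite innerDl ?innerNl //; cts.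
Qed.

Lemma innerDr f g h : continuous f -> continuous g -> continuous h ->
  I h (fun x => f x + g x) = I h f + I h g.
Proof. by move=> *; rewrite innerC innerDl // !(innerC h). Qed.

Lemma innerBr f g h : continuous f -> continuous g -> continuous h ->
  I h (fun x => f x - g x) = I h f - I h g.
Proof. by move=> *; rewrite innerC innerBl // !(innerC h). Qed.

Lemma innerZr c f h : continuous f -> continuous h ->
  I h (fun x => c * f x) = c * I h f.
Proof. by move=> *; rewrite innerC innerZl // (innerC h). Qed.

Lemma inner_ge0 f : 0 <= Q f.
Proof. by apply: Rintegral_ge0 => x _; rewrite -expr2 sqr_ge0. Qed.

Lemma inner_le f g h k : continuous f -> continuous g -> continuous h ->
  continuous k -> (forall x : R, - L <= x <= L -> f x * g x <= h x * k x) -> I f g <= I h k.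
Proof. by move=> *; apply: le_int => //; cts. Qed.

(** Young's inequality, from expanding the square of [2 * c * f - g]. It takes the place of the
    Cauchy-Schwarz inequality throughout, the parameter [c] deciding which factor is made small. *)
Lemma inner_AMGM c f g : 0 < c -> continuous f -> continuous g ->
  I f g <= c * Q f + (4 * c)^-1 * Q g.
Proof.
move=> c0 cf cg.
have : 0 <= Q (fun x => 2 * c * f x - g x) by exact: inner_ge0.
rewrite innerBl ?innerBr ?innerZl ?innerZr //; cts.
rewrite (innerC g f) => h.
have -> : c * Q f + (4 * c)^-1 * Q g = I f g +
  (4 * c)^-1 * (2 * c * (2 * c * Q f) - 2 * c * I f g - (2 * c * I f g - Q g)).
  by field; rewrite gt_eqF.
by rewrite lerDl mulr_ge0 // invr_ge0 mulr_ge0 // ltW.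
Qed.

Lemma inner_AMGM_norm c f g : 0 < c -> continuous f -> continuous g ->
  `|I f g| <= c * Q f + (4 * c)^-1 * Q g.
Proof.
move=> c0 cf cg; rewrite ler_norml inner_AMGM // andbT lerNl.
rewrite -innerNl //; apply: le_trans (inner_AMGM c0 _ cg) _; first exact: ctsN.
rewrite innerNl ?(innerC f) ?innerNl ?opprK //; exact: ctsN.
Qed.

(** The parallelogram identity with the square of the difference dropped. *)
Lemma innerDD f g : continuous f -> continuous g ->
  Q (fun x => f x + g x) <= 2 * Q f + 2 * Q g.
Proof.
move=> cf cg.
have : 0 <= Q (fun x => f x - g x) by exact: inner_ge0.
rewrite innerBl ?innerBr ?innerDl ?innerDr //; cts.
rewrite (innerC g f); lra.
Qed.

Lemma innerBB f g : continuous f -> continuous g ->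
  Q (fun x => f x - g x) <= 2 * Q f + 2 * Q g.
Proof.
move=> cf cg.
have : 0 <= Q (fun x => f x + g x) by exact: inner_ge0.
rewrite innerBl ?innerBr ?innerDl ?innerDr //; cts.
rewrite (innerC g f); lra.
Qed.

Lemma innerZZ c f : continuous f -> Q (fun x => c * f x) = c ^+ 2 * Q f.
Proof. move=> cf; rewrite innerZl ?innerZr //; [ring|cts..]. Qed.

Lemma innerM_le (m f : R -> R) (M : R) : continuous m -> continuous f ->
  (forall x : R, - L <= x <= L -> `|m x| <= M) ->
  Q (fun x => m x * f x) <= M ^+ 2 * Q f.
Proof.
move=> cm cf hM; rewrite -innerZl //.
apply: inner_le; cts => x xL.
rewrite -expr2 exprMn -mulrA -expr2 ler_wpM2r ?sqr_ge0 //.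
by rewrite -(real_normK (num_real (m x))) lerXn2r ?nnegrE ?(le_trans _ (hM x xL)) // hM.
Qed.

Lemma inner_sup_le f M : continuous f ->
  (forall x : R, - L <= x <= L -> `|f x| <= M) -> Q f <= 2 * L * M ^+ 2.
Proof.
move=> cf hM.
have h : Q f <= int (- L) L (fun=> M ^+ 2).
  apply: le_int; cts => x xL.
  rewrite -expr2 -(real_normK (num_real (f x))).
  by rewrite lerXn2r ?nnegrE ?(le_trans _ (hM x xL)) // hM.
apply: le_trans h _; rewrite int_cst //; lra.
Qed.

Lemma inner_by_parts f g : C1per L f -> C1per L g ->
  I (derive1 f) g = - I f (derive1 g).
Proof.
move=> cf cg; apply/eqP; rewrite -addr_eq0 /inner.
rewrite -intD; [|cts..].
have dfg (x : R) : is_derive x 1 (fun x => f x * g x)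
    (derive1 f x * g x + f x * derive1 g x).
  rewrite addrC [derive1 f x * _]mulrC.
  by apply: is_deriveMf; eapply C1per_derive; eassumption.
rewrite (FTC LL dfg); last by cts.
have := C1per_per cf (- L); have := C1per_per cg (- L).
by rewrite (_ : - L + 2 * L = L); [move=> -> ->; rewrite subrr|ring].
Qed.

(** Since [2 * |f * f'| <= f^2 + f'^2], the variation of [f^2] between two points is at most the
    increment of [G], hence at most the squared H^1 norm. Averaging over [y] adds the mean of [f^2],
    which is the origin of the term [(2 * L)^-1]. *)
Lemma sobolev f : C1per L f -> forall x : R, - L <= x <= L ->
  f x ^+ 2 <= (1 + (2 * L)^-1) * (Q f + Q (derive1 f)).
Proof.
move=> cf x xL.
pose g y := f y * f y + derive1 f y * derive1 f y.
have cg : continuous g by rewrite /g; cts.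
have [G dG] := primitive cg.
have Gint y z : y <= z -> G z - G y = int y z g by move=> yz; rewrite (FTC yz dG).
have g0 y : 0 <= g y by rewrite addr_ge0 // -expr2 sqr_ge0.
have Gmono y z : y <= z -> G y <= G z.
  by move=> yz; rewrite -subr_ge0 Gint //; exact: Rintegral_ge0.
have df2 (y : R) : is_derive y 1 (fun z => f z * f z) (f y * derive1 f y + f y * derive1 f y).
  by apply: is_deriveMf; eapply C1per_derive; eassumption.
have key y z : y <= z -> `|f z * f z - f y * f y| <= G z - G y.
  move=> yz.
  have cd : continuous (fun y => f y * derive1 f y + f y * derive1 f y).
    by cts.
  rewrite Gint // -(FTC yz df2) // ler_norml; apply/andP; split; last first.
    by apply: le_int => // w _; have := sqr_ge0 (f w - derive1 f w); rewrite /g; lra.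
  rewrite lerNl -mulN1r -intZ //; apply: le_int; cts.
  by move=> w _; have := sqr_ge0 (f w + derive1 f w); rewrite /g; lra.
have GL : G L - G (- L) = Q f + Q (derive1 f).
  by rewrite Gint // /inner intD; [|cts..].
have h (y : R) : - L <= y <= L -> f x ^+ 2 <= f y * f y + (G L - G (- L)).
  move=> /andP[y1 y2]; move/andP: xL => [x1 x2]; rewrite expr2.
  have [yx|/ltW xy] := leP y x.
    have := key _ _ yx; have := Gmono _ _ y1; have := Gmono _ _ x2.
    rewrite ler_norml => ? ? /andP[_]; lra.
  have := key _ _ xy; have := Gmono _ _ x1; have := Gmono _ _ y2.
  rewrite ler_norml => ? ? /andP[+ _]; lra.
have : int (- L) L (fun=> f x ^+ 2) <= int (- L) L (fun y => f y * f y + (G L - G (- L))).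
  by apply: le_int => //; cts.
rewrite intD; [|cts..].
rewrite !int_cst // -/(inner L f f) GL.
have := inner_ge0 (derive1 f); have := inner_ge0 f.
set q := Q f; set q' := Q (derive1 f) => q0 q'0 H.
have -> : (1 + (2 * L)^-1) * (q + q') = (q + q' + (q + q') * (L - - L)) / (L - - L).
  by rewrite (_ : L - - L = 2 * L); [field; rewrite gt_eqF|ring].
rewrite ler_pdivlMr; last by rewrite opprK addr_gt0.
clear -q0 q'0 H; lra.
Qed.

(** The left side has derivative zero in [x] by periodicity, so every window of length [2 * L]
    carries the same integral. *)
Lemma primitive_per g G : continuous g -> per2L L g ->
  (forall x : R, is_derive x 1 G (g x)) ->
  forall x, G (x + L) - G (x - L) = int (- L) L g.
Proof.
move=> cg pg dG x.
have dH (y : R) : is_derive y 1 (fun y => G (y + L) - G (y - L)) 0.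
  rewrite (_ : 0 = g (y + L) - g (y - L)).
    by apply: is_deriveBf; exact: is_derive_comp_shift.
  by rewrite -(pg (y - L)) (_ : y - L + 2 * L = y + L) ?subrr //; ring.
have := @is_derive_0_is_cst _ _ x 0 dH.
by rewrite (FTC LL dG) // add0r sub0r.
Qed.

End Inner.

(** * Convolution with an integrable kernel *)

Section Convolution.
Variable R : realType.
Local Notation leb := (@lebesgue_measure R).
Local Notation int a b f := (\int[leb]_(x in `[a, b]) f x).

(** The interval is a parameter because the kernel is later cut into a singular part on [[0, d]] and
    a smooth part on [[d, L]], treated by the same lemmas. *)
Definition kconv (a b : R) (k g : R -> R) (x : R) : R :=
  \int[leb]_(xi in `[a, b]) (k xi * g (x - xi)).

Variables (a b : R) (k : R -> R).
Hypothesis ik : leb.-integrable `[a, b] (EFin \o k).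
Hypothesis k0 : forall x : R, a <= x <= b -> 0 <= k x.
Implicit Types (f g G : R -> R).
Local Notation cv := (kconv a b k).
Let kappa := int a b k.

Lemma cts_translate f (c : R) : continuous f -> continuous (fun x => f (x + c)).
Proof. by move=> cf; apply: (cts_comp cf); apply: ctsD; [exact: cts_id|exact: cts_cst]. Qed.

Lemma cts_reflect f (c : R) : continuous f -> continuous (fun x => f (c - x)).
Proof.
by move=> cf; apply: (cts_comp cf); apply: ctsD; [exact: cts_cst|apply: ctsN; exact: cts_id].
Qed.

Lemma kernel_integrable p : continuous p ->
  leb.-integrable `[a, b] (EFin \o (fun xi => k xi * p xi)).
Proof.
move=> cp; rewrite (_ : EFin \o _ = (EFin \o k) \* (EFin \o p))%E; last exact/funext.
apply: integrableMl => //.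
  apply: measurable_funTS; exact: continuous_measurable_fun.
have [M M0 hM] := @cts_bounded R p a b cp.
exists M; split; first exact: num_real.
move=> N MN x /=; rewrite in_itv /= => xab.
by apply: (le_trans (hM x xab)); exact: ltW.
Qed.

Lemma kconv_integrable g x : continuous g ->
  leb.-integrable `[a, b] (EFin \o (fun xi => k xi * g (x - xi))).
Proof. by move=> cg; apply: (@kernel_integrable (fun xi => g (x - xi))); exact: cts_reflect. Qed.

Lemma kappa_ge0 : 0 <= kappa.
Proof. by apply: Rintegral_ge0 => x /=; rewrite in_itv; exact: k0. Qed.

Lemma kconvD f g x : continuous f -> continuous g ->
  cv (fun x => f x + g x) x = cv f x + cv g x.
Proof.
move=> cf cg; rewrite /kconv; under eq_Rintegral do rewrite mulrDr.
by rewrite RintegralD //; exact: kconv_integrable.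
Qed.

Lemma kconvZ c f x : continuous f -> cv (fun x => c * f x) x = c * cv f x.
Proof.
move=> cf; rewrite /kconv; under eq_Rintegral do rewrite mulrCA.
by rewrite RintegralZl //; exact: kconv_integrable.
Qed.

Lemma kconv_le f g x y : continuous f -> continuous g ->
  (forall xi : R, a <= xi <= b -> f (x - xi) <= g (y - xi)) -> cv f x <= cv g y.
Proof.
move=> cf cg h; apply: le_Rintegral => //; try exact: kconv_integrable.
move=> xi /=; rewrite in_itv /= => xab.
by apply: ler_wpM2l; [exact: k0|exact: h].
Qed.

Lemma kconv_cst c x : cv (fun=> c) x = kappa * c.
Proof. by rewrite /kconv RintegralZr. Qed.

(** Supplies the dominating function [M * |k|], uniformly for [y] near [x], for continuity and
    differentiation under the integral sign. *)
Lemma translate_bounded g x : continuous g ->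
  exists2 M : R, 0 < M & forall y xi : R, `]x - 1, x + 1[%classic y -> `[a, b]%classic xi ->
    `|g (y - xi)| <= M.
Proof.
move=> cg; have [M M0 hM] := @cts_bounded R g (x - 1 - b) (x + 1 - a) cg.
exists M => // y xi /=; rewrite !in_itv /= => /andP[y1 y2] /andP[x1 x2].
by apply: hM; lra.
Qed.

Lemma dominant_integrable (M : R) : leb.-integrable `[a, b] (EFin \o (fun xi => M * `|k xi|)).
Proof.
rewrite (_ : EFin \o _ = (fun xi => M%:E * (`|k xi|%:E))%E).
  by apply: integrableZl => //; exact: integrable_norm.
by apply/funext => y /=; rewrite EFinM.
Qed.

Lemma kconv_cts g : continuous g -> continuous (cv g).
Proof.
move=> cg x.
have [M M0 hM] := translate_bounded x cg.
apply: (@continuity_under_integral R _ _ leb (fun x xi => k xi * g (x - xi))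
  `[a, b] _ (x - 1) (x + 1) _ _ (fun xi => M * `|k xi|)) => //.
- by move=> y _; exact: kconv_integrable.
- apply: aeW => xi _ y _.
  apply: (@ctsM R (fun=> k xi) (fun y => g (y - xi))); first exact: cts_cst.
  exact: cts_translate.
- exact: dominant_integrable.
- move=> y Iy; apply: aeW => xi xab.
  by rewrite normrM mulrC ler_wpM2r // hM.
- by rewrite inE /= in_itv /=; apply/andP; split; lra.
Qed.

(** The derivative falls on [G] and never on the kernel, so a singular but integrable kernel is
    allowed. *)
Lemma kconv_is_derive G g : continuous g -> (forall x : R, is_derive x 1 G (g x)) ->
  forall x : R, is_derive x 1 (cv G) (cv g x).
Proof.
move=> cg dG x.
have cG := cts_derive dG.
have [M M0 hM] := translate_bounded x cg.
pose F (y xi : R) := k xi * G (y - xi).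
have dF (y xi : R) : is_derive y 1 (F ^~ xi) (k xi * g (y - xi)).
  by apply: is_deriveZf; apply: is_derive_comp_shift.
have dFE y xi : partial1of2 F y xi = k xi * g (y - xi).
  exact: derive1_val.
have xI : `]x - 1, x + 1[%classic x by rewrite /= in_itv /=; apply/andP; split; lra.
have h1 : forall y : R, `]x - 1, x + 1[%classic y -> leb.-integrable `[a, b] (EFin \o F y).
  by move=> y _; exact: kconv_integrable.
have h2 : forall y xi : R, `]x - 1, x + 1[%classic y -> `[a, b]%classic xi ->
    derivable (F ^~ xi) y 1.
  by move=> y xi _ _; case: (dF y xi).
have h3 xi : 0 <= M * `|k xi| by rewrite mulr_ge0 // ltW.
have h4 : forall y xi : R, `]x - 1, x + 1[%classic y -> `[a, b]%classic xi ->
    `|partial1of2 F y xi| <= M * `|k xi|.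
  by move=> y xi Iy xab; rewrite dFE normrM mulrC ler_wpM2r // hM.
have mab : measurable (`[a, b] : set R) by [].
have e1 := @differentiation_under_integral R _ _ leb F _ mab _ _ _ xI h1 h2 (fun xi => M * `|k xi|) h3 (dominant_integrable M) h4.
have e2 := @derivable_under_integral R _ _ leb F _ mab _ _ _ xI h1 h2 (fun xi => M * `|k xi|) h3 (dominant_integrable M) h4.
split; first exact: e2.
rewrite -derive1E [LHS]e1; apply: eq_Rintegral => xi _; exact: dFE.
Qed.

Variable L : R.
Hypothesis L0 : 0 < L.

Lemma kconv_per g : per2L L g -> per2L L (cv g).
Proof.
move=> pg x; apply: eq_Rintegral => xi _.
by rewrite -addrA [2 * L + _]addrC addrA pg.
Qed.

(* Fubini for the convolution of a periodic function, obtained from the fundamental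
   theorem of calculus because differentiation commutes with convolution. *)
Lemma int_kconv g : continuous g -> per2L L g ->
  int (- L) L (cv g) = kappa * int (- L) L g.
Proof.
move=> cg pg; have [G dG] := primitive cg.
have LL : - L <= L by rewrite ge0_cp // ltW.
have cG := cts_derive dG.
rewrite (FTC LL (kconv_is_derive cg dG)); last exact: kconv_cts.
rewrite /kconv -RintegralB //; try exact: kconv_integrable.
rewrite -RintegralZr //; apply: eq_Rintegral => xi _.
rewrite -mulrBr -(primitive_per L0 cg pg dG (- xi)); congr (_ * (G _ - G _)); ring.
Qed.

(** Young's inequality is applied to [f (x - xi) * g x] under the convolution integral; integrating
    over the period with [int_kconv] then extracts the mass [kappa] of the kernel. *)
Lemma inner_kconv_le c f g : 0 < c -> continuous f -> per2L L f -> continuous g ->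
  `|inner L (cv f) g| <= kappa * (c * inner L f f + (4 * c)^-1 * inner L g g).
Proof.
move=> c0 cf pf cg.
have cff : continuous (fun x => f x * f x) by exact: ctsM.
have cgg : continuous (fun x => g x * g x) by exact: ctsM.
have pff : per2L L (fun x => f x * f x) by move=> x; rewrite pf.
have -> : kappa * (c * inner L f f + (4 * c)^-1 * inner L g g) =
    int (- L) L (fun x => c * cv (fun x => f x * f x) x + (4 * c)^-1 * kappa * (g x * g x)).
  have cc := kconv_cts cff.
  rewrite intD; [|cts..]; rewrite intZ; [|cts..]; rewrite intZ; [|cts..].
  rewrite (int_kconv cff pff) /inner; ring.
(* The sign [s] covers both sides of the absolute value at once. *)
have pos (s x : R) : s ^+ 2 = 1 ->
    s * (cv f x * g x) <= c * cv (fun x => f x * f x) x + (4 * c)^-1 * kappa * (g x * g x).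
  move=> s1.
  have -> : s * (cv f x * g x) = cv (fun y => s * g x * f y) x by rewrite kconvZ //; ring.
  have -> : c * cv (fun x => f x * f x) x + (4 * c)^-1 * kappa * (g x * g x) =
      cv (fun y => c * (f y * f y) + (4 * c)^-1 * (g x * g x)) x.
    by rewrite kconvD; [rewrite kconvZ // kconv_cst; ring|cts..].
  apply: kconv_le; [cts..|].
  move=> xi _; have := sqr_ge0 (2 * c * f (x - xi) - s * g x).
  have -> : c * (f (x - xi) * f (x - xi)) + (4 * c)^-1 * (g x * g x) = s * g x * f (x - xi) +
    (4 * c)^-1 * ((2 * c * f (x - xi) - s * g x) ^+ 2 + (1 - s ^+ 2) * g x ^+ 2).
    by field; rewrite gt_eqF.
  rewrite s1 subrr mul0r addr0 => h.
  by rewrite lerDl mulr_ge0 // invr_ge0 mulr_ge0 // ltW.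
have ccf := kconv_cts cf; have ccff := kconv_cts cff.
rewrite ler_norml; apply/andP; split.
  rewrite lerNl -mulN1r /inner -intZ; [|cts..].
  by apply: le_int; [cts..|] => x _; apply: pos; rewrite sqrrN expr1n.
apply: le_int; [cts..|] => x _.
by rewrite -[_ * _]mul1r; apply: pos; rewrite expr1n.
Qed.

End Convolution.

(** * The nonlocal operator *)

Section Kernel.
Variable R : realType.
Local Notation leb := (@lebesgue_measure R).
Local Notation int a b f := (\int[leb]_(x in `[a, b]) f x).

(* [kern 0 = 0], since [0 `^ p = 0] for [p != 0]; only a null set is affected. *)
Definition kern (xi : R) : R := `|xi| `^ (- 3^-1).

Lemma nonlocalJE (L : R) (f : R -> R) : nonlocalJ L f = kconv 0 L kern (derive1 f).
Proof. by []. Qed.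

Lemma kern_ge0 (x : R) : 0 <= kern x.
Proof. exact: powR_ge0. Qed.

(** Meant for powers of [x], which are differentiable on [[a, b]] with [0 < a] but not on the whole
    line. *)
Lemma is_derive_itv (F f : R -> R) (a b : R) :
  (forall x : R, a <= x <= b -> is_derive x 1 F (f x)) ->
  a < b ->
  [/\ {within `[a, b], continuous F}, derivable_oo_LRcontinuous F a b &
      {in `]a, b[, derive1 F =1 f}].
Proof.
move=> dF ab.
have cF : forall x : R, a <= x <= b -> {for x, continuous F}.
  move=> x xab; apply/differentiable_continuous/derivable1_diffP.
  by case: (dF x xab).
split.
- apply: continuous_in_subspaceT => x; rewrite inE /= in_itv /=; exact: cF.
- split.
  + move=> x; rewrite in_itv /= => /andP[/ltW ax /ltW xb].
    by case: (dF x); rewrite ?ax ?xb.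
  + by apply: cvg_at_right_filter; apply: cF; rewrite lexx ltW.
  + by apply: cvg_at_left_filter; apply: cF; rewrite lexx ltW.
- move=> x; rewrite in_itv /= => /andP[/ltW ax /ltW xb].
  by apply: derive1_val; apply: dF; rewrite ax xb.
Qed.

Lemma powR_cts (p x : R) : 0 < x -> {for x, continuous (fun y : R => y `^ p)}.
Proof.
move=> x0; apply/differentiable_continuous/derivable1_diffP.
by have := @is_derive1_powR R p _ x0 => -[].
Qed.

Lemma powR_within_cts (p a b : R) : 0 < a ->
  {within `[a, b], continuous (fun x : R => x `^ p)}.
Proof.
move=> a0; apply: continuous_in_subspaceT => x; rewrite inE /= in_itv /= => /andP[ax _].
exact/powR_cts/(lt_le_trans a0 ax).
Qed.

Lemma int_kern_itv (e d : R) : 0 < e -> e < d ->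
  (\int[leb]_(x in `[e, d]) (kern x)%:E <= (3 / 2 * d `^ (2 / 3))%:E)%E.
Proof.
move=> e0 ed.
have -> : (\int[leb]_(x in `[e, d]) (kern x)%:E = \int[leb]_(x in `[e, d]) (x `^ (- 3^-1))%:E)%E.
  apply: eq_integral => x; rewrite inE /= in_itv /= => /andP[ex _]; rewrite /kern gtr0_norm //.
  exact: lt_le_trans ex.
have dF : forall x : R, e <= x <= d ->
    is_derive x 1 (fun x => 3 / 2 * x `^ (2 / 3)) (x `^ (- 3^-1)).
  move=> x /andP[ex _].
  have e1 : 3 / 2 * (2 / 3) = 1 :> R by field.
  have e2 : 2 / 3 - 1 = - 3^-1 :> R by field.
  have := is_deriveZf (3 / 2) (@is_derive1_powR R (2 / 3) _ (lt_le_trans e0 ex)).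
  by rewrite mulrA e1 mul1r e2.
have [_ dd df] := is_derive_itv dF ed.
rewrite (continuous_FTC2 ed (@powR_within_cts (- 3^-1) e d e0) dd df) -EFinB lee_fin.
by rewrite gerBl mulr_ge0 // powR_ge0.
Qed.

Lemma kern_measurable (D : set (measurableTypeR R)) : measurable_fun D (kern : measurableTypeR R -> measurableTypeR R).
Proof.
apply: measurable_funTS; apply: (measurableT_comp (measurable_powR _)).
exact: normr_measurable.
Qed.

Lemma kern_integrable (d : R) : 0 < d -> leb.-integrable `[0, d] (EFin \o kern).
Proof.
move=> d0; apply/integrableP; split; first (apply/measurable_EFinP; exact: kern_measurable).
under eq_integral do rewrite /= ger0_norm ?kern_ge0 //.
rewrite -integral_itv_obnd_cbnd; last first.
  apply/measurable_EFinP; exact: kern_measurable.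
(* The intervals exhaust []0, d]] from inside; [n.+2] rather than [n.+1] keeps the left end strictly
   below [d] already for [n = 0]. *)
pose F (n : nat) := `[d * (n.+2%:R)^-1, d]%classic : set R.
have UF : `]0%R, d]%classic = \bigcup_n F n.
  apply/seteqP; split => x /=.
    rewrite in_itv /= => /andP[x0 xd].
    have [n _ hn] := near_infty_natSinv_lt (PosNum (divr_gt0 x0 d0)).
    exists n => //; rewrite /F /= in_itv /= xd andbT mulrC -ler_pdivlMr //.
    apply/ltW/(le_lt_trans _ (hn n (leqnn n))) => /=.
    by rewrite lef_pV2 ?posrE ?ltr0n // ler_nat.
  move=> [n _]; rewrite /F /= !in_itv /= => /andP[nx ->]; rewrite andbT.
  by apply: lt_le_trans nx; rewrite mulr_gt0 // invr_gt0 ltr0n.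
have c : (\int[leb]_(x in F i) (kern x)%:E)%E @[i --> \oo] -->
    (\int[leb]_(x in `]0%R, d]) (kern x)%:E)%E.
  rewrite UF; apply: ge0_nondecreasing_set_cvg_integral.
  - move=> n m nm; rewrite subsetEset => x; rewrite /F /= !in_itv /= => /andP[h ->].
    rewrite andbT; apply: le_trans h; rewrite ler_pM2l //.
    by rewrite lef_pV2 ?posrE ?ltr0n // ler_nat !ltnS.
  - by move=> i; exact: measurable_itv.
  - by move=> i; apply/measurable_EFinP; exact: kern_measurable.
  - by move=> i x _; rewrite lee_fin kern_ge0.
apply: (@le_lt_trans _ _ (3 / 2 * d `^ (2 / 3))%:E); last exact: ltry.
rewrite -(cvg_lim _ c) //; apply: lime_le; first by apply/cvg_ex; eexists; exact: c.
apply: nearW => n; apply: int_kern_itv.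
  by rewrite mulr_gt0 // invr_gt0 ltr0n.
by rewrite gtr_pMr // invf_lt1 ?ltr0n // ltr1n.
Qed.

(** The integral of an integrable function over [[0, x]] tends to 0 with [x]. *)
Lemma kern_small (L e : R) : 0 < L -> 0 < e ->
  exists d : R, [/\ 0 < d, d < L & int 0 d kern <= e].
Proof.
move=> L0 e0.
have h := parameterized_integral_cvg_left L0 (kern_integrable L0).
have [d d0 hd] : \forall x \near (0 : R), `|0 - int 0 x kern| < e.
  by move/cvgrPdist_lt : h => /(_ _ e0).
pose x := Num.min (d / 2) (L / 2).
have x0 : 0 < x by rewrite lt_min !divr_gt0.
have xd : x < d by rewrite gt_min ltr_pdivrMr // mulr_natr mulr2n ltrDr d0.
exists x; split => //.
  by rewrite gt_min [in X in _ || X]ltr_pdivrMr // mulr_natr mulr2n ltrDr L0 orbT.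
have := hd x; rewrite /= !sub0r !normrN gtr0_norm // => /(_ xd) /ltW.
exact/le_trans/ler_norm.
Qed.

End Kernel.

(** * The Garding-type inequality for the nonlocal operator *)

Section Garding.
Variable R : realType.
Local Notation leb := (@lebesgue_measure R).
Local Notation int a b f := (\int[leb]_(x in `[a, b]) f x).
Variable L : R.
Hypothesis L0 : 0 < L.
Local Notation Q f := (inner L f f).
Implicit Types f g : R -> R.

Lemma inner_translate f (d : R) : continuous f -> per2L L f ->
  Q (fun x => f (x - d)) = Q f.
Proof.
move=> cf pf.
have cff : continuous (fun x => f x * f x) by exact: ctsM.
have pff : per2L L (fun x => f x * f x) by move=> x; rewrite pf.
have [G dG] := primitive cff.
have LL : - L <= L by rewrite ge0_cp // ltW.
have dG' (x : R) : is_derive x 1 (fun x => G (x - d)) (f (x - d) * f (x - d)).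
  exact: is_derive_comp_shift.
rewrite {1}/inner (FTC LL dG'); last first.
  by apply: ctsM; exact: cts_translate.
apply: etrans (primitive_per L0 cff pff dG (- d)); congr (G _ - G _); ring.
Qed.

Lemma kconv_kern_split f (d x : R) : 0 < d -> d < L -> continuous f ->
  kconv 0 L (@kern R) f x = kconv 0 d (@kern R) f x + kconv d L (@kern R) f x.
Proof.
move=> d0 dL cf; rewrite /kconv.
have i1 := kconv_integrable (kern_integrable L0) x cf.
have h := @Rintegral_itvB R (fun xi => kern xi * f (x - xi)) (BLeft 0) (BRight L) d i1.
rewrite Rintegral_itv_obnd_cbnd in h; last first.
  apply: integrableS i1 => //; apply: subset_itvr; rewrite bnd_simp; exact: ltW.
rewrite -h ?bnd_simp; [ring|exact: ltW..].
Qed.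

(** In the variable [xi], [- f (x - xi)] is a primitive of [derive1 f (x - xi)]. The boundary terms
    are translates of [f], with the same L^2 norm over a period, and the differentiated kernel is
    written with its sign outside, so that it is nonnegative and the convolution bound applies to
    it. *)
Lemma kconv_kern_by_parts f (d x : R) : 0 < d -> d < L -> C1per L f ->
  kconv d L (@kern R) (derive1 f) x =
  d `^ (- 3^-1) * f (x - d) - L `^ (- 3^-1) * f (x - L)
  - kconv d L (fun xi => 3^-1 * xi `^ (- 3^-1 - 1)) f x.
Proof.
move=> d0 dL cf.
have pos xi : d <= xi <= L -> 0 < xi by case/andP=> dx _; exact: lt_le_trans dx.
have -> : kconv d L (@kern R) (derive1 f) x = int d L (fun xi => xi `^ (- 3^-1) * derive1 f (x - xi)).
  apply: eq_Rintegral => xi; rewrite inE /= in_itv /= => /pos xi0; by rewrite /kern gtr0_norm.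
have dG (xi : R) : is_derive xi 1 (fun xi => - f (x - xi)) (derive1 f (x - xi)).
  have h1 : is_derive xi 1 (fun xi : R => x - xi) (- 1).
    by rewrite -(sub0r 1); apply: is_deriveBf.
  have h2 := @is_derive1_comp _ f _ xi _ _ (C1per_derive (x - xi) cf) h1.
  rewrite -[X in is_derive _ _ _ X]opprK -[X in - - X]mulr1 -mulrN.
  exact: is_deriveN h2.
have dF (xi : R) : d <= xi <= L ->
    is_derive xi 1 (fun x : R => x `^ (- 3^-1)) (- 3^-1 * xi `^ (- 3^-1 - 1)).
  by move=> /pos xi0; exact: is_derive1_powR.
have [_ F1 F2] := is_derive_itv dF dL.
have [_ G1 G2] := is_derive_itv (fun xi _ => dG xi) dL.
have cf' : {within `[d, L], continuous (fun xi => - 3^-1 * xi `^ (- 3^-1 - 1))}.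
  apply: continuous_in_subspaceT => xi; rewrite inE /= in_itv /= => /pos xi0.
  apply: cvgM; first exact: cvg_cst.
  exact: powR_cts xi0.
have cg : {within `[d, L], continuous (fun xi => derive1 f (x - xi))}.
  by apply: continuous_subspaceT; apply: cts_reflect; exact: C1per_dcts cf.
rewrite (Rintegration_by_parts dL cf' F1 F2 cg G1 G2).
under eq_Rintegral do rewrite mulNr mulrNN.
rewrite /kconv; ring.
Qed.

(* The kernel has small mass on [[0, d]]; on [[d, L]] integration by parts moves the
   derivative from [f] to the kernel, which is smooth there. *)
Lemma garding (e : R) : 0 < e -> exists2 C : R, 0 < C &
  forall f, C1per L f ->
    `|inner L (nonlocalJ L f) (derive1 f)| <= e * Q (derive1 f) + C * Q f.
Proof.
move=> e0.
(* With Young parameter 1 the singular part costs at most [e / 4 * (1 + 1 / 4)], which is below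
   [e / 2]. *)
have [d [d0 dL hd]] := kern_small L0 (divr_gt0 e0 (ltr0n _ 4)).
pose k1 (xi : R) : R := 3^-1 * xi `^ (- 3^-1 - 1).
have ik1 : leb.-integrable `[d, L] (EFin \o k1).
  apply: continuous_compact_integrable; first exact: segment_compact.
  apply: continuous_in_subspaceT => xi; rewrite inE /= in_itv /= => /andP[dx _].
  apply: cvgM; first exact: cvg_cst.
  exact: powR_cts (lt_le_trans d0 dx).
have k10 (xi : R) : 0 <= k1 xi by rewrite mulr_ge0 ?powR_ge0.
have ik0 := kern_integrable d0.
have kern0 (xi : R) : 0 <= xi <= d -> 0 <= kern xi by rewrite kern_ge0.
pose kd := d `^ (- 3^-1); pose kL := L `^ (- 3^-1); pose K1 := int d L k1.
have kd0 : 0 < kd by rewrite powR_gt0.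
have kL0 : 0 <= kL by rewrite powR_ge0.
have K10 : 0 <= K1 by exact: (kappa_ge0 (fun xi _ => k10 xi)).
(* [B] is the total weight of the two boundary terms and the smooth kernel; [c] is tuned so that
   [B / (4 * c) = e / 2], the other half of [e]. *)
pose B := kd + kL + K1; pose c := B / (2 * e).
have B0 : 0 < B by rewrite /B; lra.
have c0 : 0 < c by rewrite divr_gt0 // mulr_gt0.
exists (B * c); first exact: mulr_gt0.
move=> f cf.
have cdf := C1per_dcts cf; have pdf := C1per_dper cf; have pf := C1per_per cf.
have cff := C1per_cts cf.
pose s1 x := f (x - d); pose s2 x := f (x - L).
have cs1 : continuous s1 by exact: cts_translate.
have cs2 : continuous s2 by exact: cts_translate.
pose c1 := kconv 0 d (@kern R) (derive1 f); pose c2 := kconv d L k1 f.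
have cc1 : continuous c1 by apply: kconv_cts.
have cc2 : continuous c2 by apply: kconv_cts.
have -> : nonlocalJ L f = fun x => c1 x + (kd * s1 x - kL * s2 x - c2 x).
  apply/funext => x; rewrite nonlocalJE (kconv_kern_split x d0 dL cdf).
  by rewrite (kconv_kern_by_parts x d0 dL cf).
rewrite innerDl; [|cts..]; rewrite !innerBl; [|cts..]; rewrite !innerZl; [|cts..].
have h1 := inner_kconv_le ik0 kern0 L0 ltr01 cdf pdf cdf.
have h2 := inner_kconv_le ik1 (fun xi _ => k10 xi) L0 c0 cff pf cdf.
have h3 := inner_AMGM_norm L c0 cs1 cdf.
have h4 := inner_AMGM_norm L c0 cs2 cdf.
rewrite (inner_translate _ cff pf) in h3; rewrite (inner_translate _ cff pf) in h4.
have q0 := inner_ge0 L f; have q'0 := inner_ge0 L (derive1 f).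
rewrite -/c1 in h1; rewrite -/c2 -/K1 in h2.
set M := c * Q f + (4 * c)^-1 * Q (derive1 f) in h2 h3 h4.
have BM : B * M = B * c * Q f + e / 2 * Q (derive1 f).
  rewrite /M /c; field; rewrite ?gt_eqF //.
have t1 : `|kd * inner L s1 (derive1 f)| <= kd * M.
  by rewrite normrM gtr0_norm // ler_wpM2l // ltW.
have t2 : `|kL * inner L s2 (derive1 f)| <= kL * M.
  by rewrite normrM ger0_norm // ler_wpM2l.
have t3 : int 0 d (@kern R) * (1 * Q (derive1 f) + (4 * 1)^-1 * Q (derive1 f)) <= e / 2 * Q (derive1 f).
  apply: (@le_trans _ _ (e / 4 * (1 * Q (derive1 f) + (4 * 1)^-1 * Q (derive1 f)))).
    by apply: ler_wpM2r => //; lra.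
  clear -e0 q'0; nra.
have -> : e * Q (derive1 f) + B * c * Q f = e / 2 * Q (derive1 f) + B * M.
  by rewrite BM; field.
rewrite /B !mulrDl.
apply: le_trans (ler_normD _ _) _; apply: lerD; first exact: le_trans h1 t3.
apply: le_trans (ler_normB _ _) _; apply: lerD => //.
by apply: le_trans (ler_normB _ _) _; apply: lerD.
Qed.

End Garding.

(** * The H^1 projection *)

Section Projection.
Variable R : realType.
Variable L : R.
Hypothesis L0 : 0 < L.
Implicit Types f g w W : R -> R.
Local Notation C1 := (C1per L).

Definition inner1 f g : R := inner L f g + inner L (derive1 f) (derive1 g).

Lemma inner1C f g : inner1 f g = inner1 g f.
Proof. by rewrite /inner1 innerC [inner L (derive1 f) _]innerC. Qed.

Lemma inner1_ge0 f : 0 <= inner1 f f.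
Proof. by rewrite addr_ge0 // inner_ge0. Qed.

Lemma inner1D f g h : C1 f -> C1 g -> C1 h ->
  inner1 (fun x => f x + g x) h = inner1 f h + inner1 g h.
Proof.
move=> cf cg ch; rewrite /inner1 (derive1D_fun cf cg).
have e0 := innerDl L (C1per_cts cf) (C1per_cts cg) (C1per_cts ch).
have e1 := innerDl L (C1per_dcts cf) (C1per_dcts cg) (C1per_dcts ch).
by rewrite addrACA; exact: (congr2 +%R e0 e1).
Qed.

Lemma inner1Z c f h : C1 f -> C1 h -> inner1 (fun x => c * f x) h = c * inner1 f h.
Proof.
move=> cf ch; rewrite /inner1 (derive1Z_fun c cf).
have e0 := innerZl L c (C1per_cts cf) (C1per_cts ch).
have e1 := innerZl L c (C1per_dcts cf) (C1per_dcts ch).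
by rewrite mulrDr; exact: (congr2 +%R e0 e1).
Qed.

Lemma inner1B f g h : C1 f -> C1 g -> C1 h ->
  inner1 (fun x => f x - g x) h = inner1 f h - inner1 g h.
Proof.
move=> cf cg ch; rewrite /inner1 (derive1B_fun cf cg).
have e0 := innerBl L (C1per_cts cf) (C1per_cts cg) (C1per_cts ch).
have e1 := innerBl L (C1per_dcts cf) (C1per_dcts cg) (C1per_dcts ch).
by rewrite opprD addrACA; exact: (congr2 +%R e0 e1).
Qed.

Lemma inner1_sqr f g s : C1 f -> C1 g ->
  inner1 (fun x => f x + s * g x) (fun x => f x + s * g x) =
  inner1 f f + 2 * s * inner1 f g + s ^+ 2 * inner1 g g.
Proof.
move=> cf cg; have cs := C1perZ s cg; have cc := C1perD cf cs.
rewrite (inner1D cf cs cc) (inner1Z s cg cc) (inner1C f _) (inner1C g _).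
rewrite (inner1D cf cs cf) (inner1D cf cs cg) (inner1Z s cg cf) (inner1Z s cg cg).
rewrite (inner1C g f).
move: (inner1 f f) (inner1 f g) (inner1 g g) => a b c.
ring.
Qed.

(** If the pairing [b] were nonzero, the square of [f + s * g] would be affine in [s] with nonzero
    slope; the chosen [s] makes it equal to -1. *)
Lemma inner1_null f g : C1 f -> C1 g -> inner1 g g = 0 -> inner1 f g = 0.
Proof.
move=> cf cg g0; apply/eqP/negPn/negP => b0.
set b := inner1 f g in b0.
pose s := - (inner1 f f + 1) / (2 * b).
have := inner1_ge0 (fun x => f x + s * g x).
rewrite (inner1_sqr s cf cg) g0 -/b mulr0 addr0.
have -> : inner1 f f + 2 * s * b = - 1 by rewrite /s; field.
by rewrite oppr_ge0 ler10.
Qed.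

(** Convertible to [fe_set] when [g] generates a finite element space; freed from that record to
    allow induction on the number of generators. *)
Definition fspan n (g : 'I_n -> R -> R) : set (R -> R) :=
  [set v | exists c : 'I_n -> R, v = fun x => \sum_k c k * g k x].

Lemma fspan_C1 n (g : 'I_n -> R -> R) W : (forall k, C1 (g k)) -> fspan g W -> C1 W.
Proof. by move=> cg [c ->]; exact: C1per_sum. Qed.

Lemma fspan_comb n (g : 'I_n -> R -> R) W1 W2 t : fspan g W1 -> fspan g W2 ->
  fspan g (fun x => W1 x + t * W2 x).
Proof.
move=> [c1 ->] [c2 ->]; exists (fun k => c1 k + t * c2 k); apply/funext => x.
by rewrite mulr_sumr -big_split; apply: eq_bigr => k _ /=; ring.
Qed.

Lemma fspan_recr n (g : 'I_n.+1 -> R -> R) W :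
  fspan g W <-> exists2 W', fspan (fun k => g (widen_ord (leqnSn n) k)) W' &
    exists t, W = fun x => W' x + t * g ord_max x.
Proof.
split=> [[c ->]|[_ [c ->] [t ->]]].
  exists (fun x => \sum_(k < n) c (widen_ord (leqnSn n) k) * g (widen_ord (leqnSn n) k) x).
    by exists (fun k => c (widen_ord (leqnSn n) k)).
  by exists (c ord_max); apply/funext => x; rewrite big_ord_recr.
exists (fun k => if unlift ord_max k is Some j then c j else t).
apply/funext => x; rewrite big_ord_recr /= unlift_none; congr (_ + _).
apply: eq_bigr => k _; rewrite (_ : widen_ord (leqnSn n) k = lift ord_max k) ?liftK //.
by apply: val_inj; rewrite /= /bump leqNgt ltn_ord.
Qed.

Definition is_proj n (g : 'I_n -> R -> R) w W : Prop :=
  fspan g W /\ forall chi, fspan g chi -> inner1 (fun x => w x - W x) chi = 0.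

(** One Gram-Schmidt step per generator: [q] is the last generator minus its projection on the
    earlier ones, and the projection of [w] gains its component along [q]. The generators may be
    linearly dependent, so a Gram matrix could be singular. *)
Lemma proj_exists n (g : 'I_n -> R -> R) w : (forall k, C1 (g k)) -> C1 w ->
  exists W, is_proj g w W.
Proof.
elim: n g w => [|n IH] g w cg cw.
  exists (fun=> 0); split.
    by exists (fun=> 0); apply/funext => x; rewrite big_ord0.
  move=> chi [c ->].
  have e : (fun x => \sum_(k < 0) c k * g k x) = (fun x => 0 * w x).
    by apply/funext => x; rewrite big_ord0 mul0r.
  have c0 : C1 (fun x => w x - 0) by apply: C1perB => //; exact: C1per0.
  by rewrite e inner1C (inner1Z 0 cw c0) mul0r.
pose g' k := g (widen_ord (leqnSn n) k).
have cg' k : C1 (g' k) by exact: cg.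
pose v := g ord_max; have cv : C1 v by exact: cg.
have [V [sV pV]] := IH g' v cg' cv.
have [W0 [sW pW]] := IH g' w cg' cw.
have cV := fspan_C1 cg' sV; have cW := fspan_C1 cg' sW.
pose q x := v x - V x; have cq : C1 q by exact: C1perB.
pose w0 x := w x - W0 x; have cw0 : C1 w0 by exact: C1perB.
(* [inner1] is only positive semidefinite here: if [inner1 q q = 0] then [t = 0], and [q]
   is orthogonal to everything. *)
pose t := inner1 w0 q / inner1 q q.
have cZq := C1perZ t cq.
have tq : inner1 w0 q - t * inner1 q q = 0.
  rewrite /t; have [q0|q0] := eqVneq (inner1 q q) 0.
    by rewrite q0 mulr0 (inner1_null cw0 cq q0) subrr.
  by rewrite divfK // subrr.
exists (fun x => W0 x + t * q x); split.
  apply/fspan_recr; exists (fun x => W0 x + (- t) * V x); first exact: fspan_comb.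
  by exists t; apply/funext => x; rewrite /q /v; ring.
have -> : (fun x => w x - (W0 x + t * q x)) = fun x => w0 x - t * q x.
  by apply/funext => x; rewrite /w0; ring.
move=> _ /fspan_recr [chi sc [s ->]].
have cchi := fspan_C1 cg' sc.
pose chi' x := chi x + s * V x.
have sc' : fspan g' chi' by exact: fspan_comb.
have cc' := fspan_C1 cg' sc'.
have cw0q : C1 (fun x => w0 x - t * q x) by exact: C1perB.
have -> : (fun x => chi x + s * g ord_max x) = fun x => chi' x + s * q x.
  by apply/funext => x; rewrite /chi' /q /v; ring.
have csq := C1perZ s cq.
rewrite inner1C (inner1D cc' csq cw0q) (inner1Z s cq cw0q) (inner1C chi' _) (inner1C q _).
rewrite (inner1B cw0 cZq cc') (inner1B cw0 cZq cq) (inner1Z t cq cc') (inner1Z t cq cq).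
by rewrite (pW _ sc') (pV _ sc') tq; ring.
Qed.

(** Pythagoras: [w - chi] is the sum of [w - W] and of the orthogonal element [W - chi] of the
    span. *)
Lemma proj_best n (g : 'I_n -> R -> R) w W chi : (forall k, C1 (g k)) -> C1 w ->
  is_proj g w W -> fspan g chi ->
  inner1 (fun x => w x - W x) (fun x => w x - W x) <=
  inner1 (fun x => w x - chi x) (fun x => w x - chi x).
Proof.
move=> cg cw [sW pW] sc.
have cW := fspan_C1 cg sW; have cc := fspan_C1 cg sc.
pose e x := w x - W x; have ce : C1 e by exact: C1perB.
pose d x := W x + (-1) * chi x.
have sd : fspan g d by exact: fspan_comb.
have cd := fspan_C1 cg sd.
have -> : (fun x => w x - chi x) = fun x => e x + 1 * d x.
  by apply/funext => x; rewrite /e /d; ring.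
rewrite (inner1_sqr 1 ce cd) (pW _ sd) mulr0 addr0 lerDl expr1n mul1r.
exact: inner1_ge0.
Qed.

Lemma proj_diff n (g : 'I_n -> R -> R) w1 w2 W1 W2 c : (forall k, C1 (g k)) ->
  C1 w1 -> C1 w2 -> is_proj g w1 W1 -> is_proj g w2 W2 ->
  is_proj g (fun x => c * (w2 x - w1 x)) (fun x => c * (W2 x - W1 x)).
Proof.
move=> cg c1 c2 [s1 p1] [s2 p2]; split.
  case: s1 => a1 ->; case: s2 => a2 ->; exists (fun k => c * (a2 k - a1 k)).
  apply/funext => x; rewrite -sumrB mulr_sumr; apply: eq_bigr => k _; ring.
move=> chi sc.
have cW1 := fspan_C1 cg s1; have cW2 := fspan_C1 cg s2; have cc := fspan_C1 cg sc.
pose e1 x := w1 x - W1 x; pose e2 x := w2 x - W2 x.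
have ce1 : C1 e1 by exact: C1perB.
have ce2 : C1 e2 by exact: C1perB.
have -> : (fun x => c * (w2 x - w1 x) - c * (W2 x - W1 x)) = fun x => c * (e2 x - e1 x).
  by apply/funext => x; rewrite /e1 /e2; ring.
have ce : C1 (fun x => e2 x - e1 x) by exact: C1perB.
by rewrite (inner1Z c ce cc) (inner1B ce2 ce1 cc) (p1 _ sc) (p2 _ sc) subrr mulr0.
Qed.

End Projection.

(** * Smooth functions in Sobolev spaces *)

Section Sobolev.
Variable R : realType.
Variable L : R.
Hypothesis L0 : 0 < L.
Implicit Types f g w W : R -> R.
Local Notation leb := (@lebesgue_measure R).
Local Notation int a b f := (\int[leb]_(x in `[a, b]) f x).

Lemma Rintegral_support (a b : R) (h : R -> R) :
  (forall x, ~~ (a <= x <= b) -> h x = 0) ->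
  \int[leb]_(x in [set: R]) h x = int a b h.
Proof.
move=> h0; rewrite [RHS]Rintegral_mkcond; congr (Rintegral _ _ _).
apply/funext => x; rewrite /patch; case: ifPn => //.
by rewrite notin_setE /= in_itv => /negP /h0.
Qed.

Lemma is_derive_weak f g : (forall x : R, is_derive x 1 f (g x)) -> continuous g ->
  weak_derivative f g.
Proof.
move=> df cg phi [dphi [a phi0]].
have cf := cts_derive df.
have dp (x : R) : is_derive x 1 phi (derive1 phi x) by apply: is_derive1; exact: (dphi 0%N).
have cp := cts_derive dp.
have cdp : continuous (derive1 phi).
  by apply: cts_derive => x; apply: is_derive1; exact: (dphi 1%N).
have dphi0 x : a < `|x| -> derive1 phi x = 0.
  move=> ax; apply: derive1_val.
  apply: (@near_eq_is_derive _ _ _ (fun=> 0)).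
  exists (`|x| - a); first by rewrite /= subr_gt0.
  move=> y /= xy; rewrite phi0 //.
  have := ler_distD y x 0; rewrite !subr0 => h.
  by move: xy h; rewrite -normrN opprB; lra.
(* [a] may be negative, hence the absolute value; adding 1 puts both end points strictly into the
   region where [phi] vanishes. *)
pose A := `|a| + 1.
have aA x : ~~ (- A <= x <= A) -> a < `|x|.
  rewrite -ler_norml -ltNge; apply: le_lt_trans.
  by rewrite (le_trans (ler_norm a)) // lerDl.
rewrite !(@Rintegral_support (- A) A); last 2 first.
- by move=> x /aA /phi0 ->; rewrite mulr0.
- by move=> x /aA /dphi0 ->; rewrite mulr0.
have AA : - A <= A by rewrite ge0_cp // addr_ge0.
have dfp (x : R) : is_derive x 1 (fun x => f x * phi x) (f x * derive1 phi x + phi x * g x).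
  exact: is_deriveMf.
apply/eqP; rewrite -addr_eq0 -intD; [|cts..].
have -> : int (- A) A (fun x => f x * derive1 phi x + g x * phi x) =
   int (- A) A (fun x => f x * derive1 phi x + phi x * g x).
  by apply: eq_Rintegral => x _; rewrite [g x * _]mulrC.
rewrite (FTC AA dfp); last by cts.
rewrite !phi0 ?mulr0 ?subrr //.
  by rewrite normrN ger0_norm ?addr_ge0 // (le_lt_trans (ler_norm a)) // ltrDl.
by rewrite ger0_norm ?addr_ge0 // (le_lt_trans (ler_norm a)) // ltrDl.
Qed.

Lemma cts_L2loc f : continuous f -> L2loc f.
Proof.
move=> cf; split; first exact: continuous_measurable_fun.
move=> a.
have := @cts_integrable R (fun x => f x ^+ 2) (- a) a (@ctsX R f 2 cf).
move=> /integrableP [_]; apply: le_lt_trans.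
by rewrite le_eqVlt; apply/orP; left; apply/eqP; apply: eq_integral => x _ /=;
   rewrite ger0_norm // sqr_ge0.
Qed.

Variables (r : nat) (w : R -> R) (D : nat -> R -> R).
Hypothesis D0 : D 0%N = w.
Hypothesis pw : per2L L w.
Hypothesis dD : forall j, (j < r)%N -> forall x : R, is_derive x 1 (D j) (D j.+1 x).
Hypothesis cD : forall j, (j <= r)%N -> continuous (D j).

(** The order is the integer [r], so its truncation is exact and the Gagliardo condition is
    vacuous. *)
Lemma smooth_Hs_per : Hs_per L r%:R w D.
Proof.
split => //; rewrite /Hs_loc natrK; split => //.
- by move=> j jr; apply: cts_L2loc; exact: cD.
- by move=> j jr; apply: is_derive_weak; [exact: dD|exact: cD].
- by rewrite eqxx.
Qed.

Lemma Hs_norm_le B : 0 <= B ->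
  (forall j, (j <= r)%N -> forall x : R, - L <= x <= L -> `|D j x| <= B) ->
  Hs_norm L r%:R D <= Num.sqrt (r.+1%:R * (2 * L)) * B.
Proof.
move=> B0 hB; rewrite /Hs_norm natrK eqxx addr0.
have -> : Num.sqrt (r.+1%:R * (2 * L)) * B = Num.sqrt (r.+1%:R * (2 * L * B ^+ 2)).
  rewrite [in RHS]mulrA [in RHS]sqrtrM; last by rewrite !mulr_ge0 // ltW.
  by rewrite sqrtr_sqr ger0_norm.
rewrite ler_wsqrtr //.
have -> : r.+1%:R * (2 * L * B ^+ 2) = \sum_(j < r.+1) (2 * L * B ^+ 2).
  by rewrite sumr_const card_ord mulr_natl.
apply: ler_sum => j _; rewrite sqr_sqrtr ?inner_ge0 //.
have jr : (j <= r)%N by rewrite -ltnS.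
by apply: inner_sup_le; [exact: L0|exact: cD|exact: hB].
Qed.

End Sobolev.

(** The bound is proportional to a pointwise bound [B] of the derivatives, so that it serves the
    solution and its difference quotients in time alike. It is stated for squares, the form in which
    the energy inequality consumes it. *)
Definition projection_rate (R : realType) (L : R) (r n : nat) (g : 'I_n -> R -> R)
    (E : R) : Prop :=
  forall (w : R -> R) (D : nat -> R -> R) (B : R) (W : R -> R),
  0 < B -> D 0%N = w -> per2L L w ->
  (forall j, (j < r)%N -> forall x : R, is_derive x 1 (D j) (D j.+1 x)) ->
  (forall j, (j <= r)%N -> continuous (D j)) ->
  (forall j, (j <= r)%N -> forall x : R, - L <= x <= L -> `|D j x| <= B) ->
  is_proj L g w W ->
  inner1 L (fun x => w x - W x) (fun x => w x - W x) <= (E * B) ^+ 2.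

(** * From the approximation property to the rate of the projection *)

Section Approximation.
Variable R : realType.
Variable L : R.
Hypothesis L0 : 0 < L.
Variable r : nat.
Hypothesis r1 : (1 <= r)%N.

Lemma mesh_gt0 (S : fe_space L r) : 0 < mesh S.
Proof.
have [n0 nM lt] := fe_partition S.
have : (0 < fe_cells S)%N.
  rewrite lt0n; apply/eqP => c0; move: nM; rewrite c0 n0 => h.
  by move: L0; lra.
rewrite /mesh; case: (fe_cells S) lt => // m lt _.
apply: (@lt_le_trans _ _ (fe_nodes S 1 - fe_nodes S 0)).
  by rewrite subr_gt0; exact: lt.
exact: (@le_bigmax _ _ _ 0 (fun j : 'I_m.+1 => fe_nodes S j.+1 - fe_nodes S j) ord0).
Qed.

Lemma fe_C1 (S : fe_space L r) k : C1per L (@fe_gen R L r S k).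
Proof. by have [? ? ? _] := fe_gen_pp k. Qed.

Lemma L2norm_sqr (f : R -> R) : L2norm L f ^+ 2 = inner L f f.
Proof. by rewrite sqr_sqrtr // inner_ge0. Qed.

Lemma L2norm_ge0 (f : R -> R) : 0 <= L2norm L f.
Proof. exact: sqrtr_ge0. Qed.

Lemma L2norm_leP (f : R -> R) (c : R) : 0 <= c -> L2norm L f <= c -> inner L f f <= c ^+ 2.
Proof. by move=> c0 h; rewrite -L2norm_sqr lerXn2r ?nnegrE ?L2norm_ge0. Qed.

Variables (I : Type) (S : I -> fe_space L r).
Hypothesis AP : approximation_property S.

(** The approximation property is used at the integer order [s = r]. Its left side weights the
    derivative with [h], so dividing by [h] bounds the H^1 error by a multiple of [h ^+ r.-1]. *)
Lemma projection_error : exists2 Ca : R, 0 < Ca &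
  forall i, projection_rate L r (@fe_gen R L r (S i)) (Ca * mesh (S i) ^+ r.-1).
Proof.
have rr : 1 <= (r%:R : R) <= r%:R by rewrite lexx andbT ler1n.
have [h0 [C [h00 C0 hC]]] := AP rr.
pose K := Num.sqrt (r.+1%:R * (2 * L)).
have K0 : 0 < K by rewrite sqrtr_gt0 mulr_gt0 ?ltr0n // mulr_gt0.
pose K1 := 2 * C * K.
have K10 : 0 < K1 by rewrite !mulr_gt0.
(* The first summand serves meshes with [h <= h0]; the second serves [h > h0], where
   [(h / h0) ^+ r.-1 >= 1] and the trivial bound [4 * L * B ^+ 2 <= ((1 + 4 * L) * B) ^+ 2]
   suffices. *)
pose Ca := K1 * (1 + h0) + (1 + 4 * L) / h0 ^+ r.-1.
have h0r : 0 < h0 ^+ r.-1 by exact: exprn_gt0.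
have L4 : 0 < 1 + 4 * L by move: (L0); lra.
have h01 : 0 < 1 + h0 by lra.
have Ca0 : 0 < Ca by rewrite addr_gt0 // ?mulr_gt0 ?invr_gt0.
exists Ca => // i w D B W B0 D0 pw dD cD hB pW.
have m0 := mesh_gt0 (S i); set h := mesh (S i) in m0 *.
have hr0 : 0 < h ^+ r.-1 by exact: exprn_gt0.
rewrite mulrAC.
have D1 (x : R) : is_derive x 1 w (D 1%N x) by rewrite -D0; exact: dD.
have cw : C1per L w by apply: (C1perI pw D1); exact: cD.
have dw : derive1 w = D 1%N by exact: derive1_fun.
(* On a coarse mesh [h] is bounded below, so that the contractivity of the projection is
   enough. *)
have [hh|hh] := leP h h0; last first.
  have s0 : fspan (@fe_gen R L r (S i)) (fun=> 0).
    by exists (fun=> 0); apply/funext => x; rewrite big1 // => k _; rewrite mul0r.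
  apply: le_trans (proj_best (@fe_C1 (S i)) cw pW s0) _.
  have -> : (fun x => w x - 0) = w by apply/funext => x; rewrite subr0.
  have h1 : inner1 L w w <= 2 * L * B ^+ 2 + 2 * L * B ^+ 2.
    apply: lerD; first by apply: (inner_sup_le L0 (C1per_cts cw)); rewrite -D0; exact: hB.
    by rewrite dw; apply: (inner_sup_le L0 (cD _ r1)); exact: hB.
  apply: (le_trans h1).
  have : (1 + 4 * L) * B <= Ca * B * h ^+ r.-1.
    have -> : Ca * B * h ^+ r.-1 = Ca * h ^+ r.-1 * B by ring.
    rewrite ler_pM2r //.
    apply: (@le_trans _ _ ((1 + 4 * L) / h0 ^+ r.-1 * h ^+ r.-1)); last first.
      by rewrite ler_pM2r // lerDr mulr_ge0 // ltW.
    rewrite mulrAC ler_pdivlMr // ler_pM2l // lerXn2r ?nnegrE //; exact: ltW.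
  move=> h2; have : ((1 + 4 * L) * B) ^+ 2 <= (Ca * B * h ^+ r.-1) ^+ 2.
    by rewrite lerXn2r ?nnegrE // !mulr_ge0 // ltW.
  apply: le_trans; rewrite exprMn -mulrDl ler_wpM2r ?sqr_ge0 //.
  by move: (L0) (sqr_ge0 B) => ? ?; nra.
have hs := smooth_Hs_per D0 pw dD cD.
have := hC i hh w D hs.
rewrite -/h powR_mulrn; last exact: ltW.
set E := (X in inf X) => hinf.
(* The infimum may not be attained: doubling the bound makes the inequality strict, which relies on
   [0 < B], and an element below it exists. *)
have hE : inf E < 2 * C * h ^+ r * (K * B).
  have n1 := Hs_norm_le L0 cD (ltW B0) hB.
  apply: (le_lt_trans hinf).
  apply: (@le_lt_trans _ _ (C * h ^+ r * (K * B))).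
    by apply: ler_wpM2l => //; rewrite mulr_ge0 ?exprn_ge0 // ltW.
  by rewrite -!mulrA ltr_pMl ?ltr1n // !mulr_gt0 // exprn_gt0.
have infE : has_inf E.
  split; last first.
    exists 0 => _ [chi _ ->]; rewrite addr_ge0 ?L2norm_ge0 //.
    by rewrite mulr_ge0 ?L2norm_ge0 // ltW.
  eexists; exists (fun=> 0); last reflexivity.
  by exists (fun=> 0); apply/funext => x; rewrite big1 // => k _; rewrite mul0r.
have [_ [chi schi ->] he] : exists2 e, E e & e < 2 * C * h ^+ r * (K * B).
  have dl : 0 < 2 * C * h ^+ r * (K * B) - inf E by rewrite subr_gt0.
  have [e Ee he] := inf_adherent dl infE.
  by exists e => //; move: he; rewrite addrC subrK.
have cchi := fspan_C1 (@fe_C1 (S i)) schi.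
apply: (le_trans (proj_best (@fe_C1 (S i)) cw pW schi)).
rewrite /inner1 (derive1B_fun cw cchi) dw.
pose e := K1 * B * h ^+ r.-1.
have e0 : 0 < e by rewrite !mulr_gt0.
have ee : 2 * C * h ^+ r * (K * B) = e * h.
  have -> : h ^+ r = h ^+ r.-1 * h by rewrite -exprSr prednK.
  rewrite /e /K1; ring.
rewrite ee in he.
have q1 : inner L (fun x => w x - chi x) (fun x => w x - chi x) <= (e * h) ^+ 2.
  apply: L2norm_leP; first by rewrite mulr_ge0 // ltW.
  apply/ltW/(le_lt_trans _ he); rewrite lerDl mulr_ge0 ?L2norm_ge0 //; exact: ltW.
have q2 : inner L (fun x => D 1%N x - derive1 chi x) (fun x => D 1%N x - derive1 chi x) <= e ^+ 2.
  apply: L2norm_leP; first exact: ltW.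
  rewrite -(ler_pM2r m0); apply/ltW/(le_lt_trans _ he).
  by rewrite mulrC lerDr L2norm_ge0.
apply: (le_trans (lerD q1 q2)).
have : e * (1 + h0) <= Ca * B * h ^+ r.-1.
  have -> : Ca * B * h ^+ r.-1 =
      e * (1 + h0) + (1 + 4 * L) / h0 ^+ r.-1 * B * h ^+ r.-1 by rewrite /Ca /e; ring.
  by rewrite lerDl !mulr_ge0 // ?invr_ge0 ltW.
move=> h2; have : (e * (1 + h0)) ^+ 2 <= (Ca * B * h ^+ r.-1) ^+ 2.
  by rewrite lerXn2r ?nnegrE // !mulr_ge0 // ltW.
apply: le_trans; rewrite (exprMn _ e h) (exprMn _ e (1 + h0)) -[X in _ + X]mulr1 -mulrDr ler_wpM2l ?sqr_ge0 //.
by clear -m0 hh h00; nra.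
Qed.

End Approximation.

(** * The energy inequality *)

Section Energy.
Variable R : realType.
Variable L : R.
Hypothesis L0 : 0 < L.
Implicit Types f g : R -> R.
Local Notation C1 := (C1per L).
Local Notation I := (inner L).
Local Notation Q f := (inner L f f).

Lemma C1perM f g : C1 f -> C1 g -> C1 (fun x => f x * g x).
Proof.
move=> cf cg; apply: (@C1perI _ _ _ (fun x => f x * derive1 g x + g x * derive1 f x)).
- by move=> x; rewrite (C1per_per cf) (C1per_per cg).
- by move=> x; apply: is_deriveMf; apply: C1per_derive; [exact: cf|exact: cg].
- by cts.
Qed.

Lemma derive1M_fun f g : C1 f -> C1 g ->
  derive1 (fun x => f x * g x) = fun x => f x * derive1 g x + g x * derive1 f x.
Proof.
move=> cf cg; apply: derive1_fun => x.
by apply: is_deriveMf; apply: C1per_derive; [exact: cf|exact: cg].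
Qed.

Lemma nonlocalJ_cts f : C1 f -> continuous (nonlocalJ L f).
Proof.
move=> cf; rewrite nonlocalJE; apply: kconv_cts (C1per_dcts cf); exact: kern_integrable.
Qed.

Lemma nonlocalJD f g x : C1 f -> C1 g ->
  nonlocalJ L (fun x => f x + g x) x = nonlocalJ L f x + nonlocalJ L g x.
Proof.
move=> cf cg; rewrite !nonlocalJE (derive1D_fun cf cg).
exact: (kconvD (kern_integrable L0) x (C1per_dcts cf) (C1per_dcts cg)).
Qed.

(** Spatial flux of the equation. By parts, the equation and the scheme both become
    [I dU chi = I (flux V) (derive1 chi)]. *)
Definition flux f x : R := f x ^+ 2 / 2 - derive1 f x + nonlocalJ L f x.

Lemma flux_cts f : C1 f -> continuous (flux f).
Proof.
move=> cf; have cj := nonlocalJ_cts cf.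
rewrite /flux; apply: ctsD => //; apply: ctsD; last by apply: ctsN; exact: C1per_dcts cf.
by apply: ctsM; [apply: ctsX; exact: C1per_cts cf|exact: cts_cst].
Qed.

Lemma inner_burgers f g : C1 f -> C1 g ->
  I (fun x => f x * derive1 f x) g = - I (fun x => f x ^+ 2 / 2) (derive1 g).
Proof.
move=> cf cg.
have cff := C1perZ 2^-1 (C1perM cf cf).
have := inner_by_parts L0 cff cg.
rewrite (derive1Z_fun _ (C1perM cf cf)) (derive1M_fun cf cf).
have -> : (fun x => 2^-1 * (f x * derive1 f x + f x * derive1 f x)) = fun x => f x * derive1 f x.
  by apply/funext => x; field.
have -> // : (fun x => 2^-1 * (f x * f x)) = fun x => f x ^+ 2 / 2.
by apply/funext => x; rewrite expr2 mulrC.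
Qed.

(** The pairing of [f * f'] with [f] is minus this quantity by integration by parts, and twice this
    quantity by regrouping the factors. *)
Lemma inner_cube f : C1 f -> I (fun x => f x ^+ 2 / 2) (derive1 f) = 0.
Proof.
move=> cf.
have e1 := inner_burgers cf cf.
have e2 : I (fun x => f x * derive1 f x) f = 2 * I (fun x => f x ^+ 2 / 2) (derive1 f).
  have -> : I (fun x => f x * derive1 f x) f = I (fun x => 2 * (f x ^+ 2 / 2)) (derive1 f).
    by apply: eq_Rintegral => x _; field.
  by apply: innerZl; [apply: ctsM; [apply: ctsX; exact: C1per_cts cf|exact: cts_cst]|
     exact: C1per_dcts cf].
by rewrite e2 in e1; move: (I _ _) e1 => z; lra.
Qed.

Lemma flux_weak (dU V chi : R -> R) : C1 V -> C1 chi ->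
  I dU chi + I (V \* derive1 V) chi + I (derive1 V) (derive1 chi)
    - I (nonlocalJ L V) (derive1 chi) = 0 ->
  I dU chi = I (flux V) (derive1 chi).
Proof.
move=> cV cc.
have cj := nonlocalJ_cts cV; have cdV := C1per_dcts cV; have cdc := C1per_dcts cc.
have cs : continuous (fun x => V x ^+ 2 / 2).
  by apply: ctsM; [apply: ctsX; exact: C1per_cts cV|exact: cts_cst].
have e1 := inner_burgers cV cc.
have csd : continuous (fun x => V x ^+ 2 / 2 - derive1 V x) by apply: ctsD => //; exact: ctsN.
have e2 := innerDl L csd cj cdc.
have e3 := innerBl L cs cdV cdc.
have aux (d a b c s z z' : R) : a = - s -> z = z' + c -> z' = s - b ->
  d + a + b - c = 0 -> d = z by clear; lra.
exact: (aux _ _ _ _ _ _ _ e1 e2 e3).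
Qed.

(** Here [Y], [A], [H0], [H1], [P] are the squared norms of [th], [a], [eta], [eta'], [th']. The
    Young and Garding parameters give [P] the coefficients 1/16 three times, 1/4, and at most 1/16,
    in total 1/2, so the diffusion term [- P] absorbs them. Writing [kap + 1] in place of [kap]
    keeps the last Young parameter positive. *)
Lemma energy_sum_bound (X Y A H0 H1 P ia i1 i2 i3 j1 j2 M Cg kap K : R) :
  0 <= Y -> 0 <= A -> 0 <= H0 -> 0 <= H1 -> 0 <= P -> 0 <= kap ->
  X = - ia + i1 + i2 - P - i3 + j1 + j2 ->
  `|ia| <= 1 * A + (4 * 1)^-1 * Y ->
  `|i1| <= 4 * (M ^+ 2 * Y) + (4 * 4)^-1 * P ->
  `|i2| <= 4 * (M ^+ 2 * H0) + (4 * 4)^-1 * P ->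
  `|i3| <= 4 * H1 + (4 * 4)^-1 * P ->
  `|j1| <= 4^-1 * P + Cg * Y ->
  `|j2| <= kap * ((4 * (kap + 1)) * H1 + (4 * (4 * (kap + 1)))^-1 * P) ->
  K = 1 + 4 * M ^+ 2 + 4 + `|Cg| + 4 * kap * (kap + 1) ->
  X <= K * (Y + A + H0 + H1).
Proof.
move=> Y0 A0 H00 H10 P0 k0 -> ha h1 h2 h3 g1 g2 ->.
have hk : kap * ((4 * (kap + 1)) * H1 + (4 * (4 * (kap + 1)))^-1 * P) <=
   4 * kap * (kap + 1) * H1 + P / 16.
  have -> : kap * ((4 * (kap + 1)) * H1 + (4 * (4 * (kap + 1)))^-1 * P) =
    4 * kap * (kap + 1) * H1 + kap / (kap + 1) * (P / 16).
    by field; rewrite gt_eqF // ltr_wpDl.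
  rewrite lerD2l ler_piMl ?divr_ge0 // ler_pdivrMr ?mul1r ?lerDl // ltr_wpDl //.
have hC : Cg * Y <= `|Cg| * Y by rewrite ler_wpM2r // ler_norm.
have C0 : 0 <= `|Cg| by [].
have M0 : 0 <= M ^+ 2 by exact: sqr_ge0.
have kk : 0 <= 4 * kap * (kap + 1) by rewrite !mulr_ge0 // addr_ge0.
move: (4 * kap * (kap + 1)) kk hk => k2 k20 hk.
move: (M ^+ 2) M0 h1 h2 => m m0 h1 h2.
move: (`|Cg|) C0 hC => c c0 hC.
have := ler_norm (- ia); rewrite normrN; have := ler_norm i1; have := ler_norm i2.
have := ler_norm (- i3); rewrite normrN; have := ler_norm j1; have := ler_norm j2.
have p1 : 0 <= m * A by exact: mulr_ge0.
have p2 : 0 <= m * H1 by exact: mulr_ge0.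
have p3 : 0 <= c * A by exact: mulr_ge0.
have p4 : 0 <= c * H0 by exact: mulr_ge0.
have p5 : 0 <= c * H1 by exact: mulr_ge0.
have p6 : 0 <= k2 * A by exact: mulr_ge0.
have p7 : 0 <= k2 * H0 by exact: mulr_ge0.
have p8 : 0 <= k2 * Y by exact: mulr_ge0.
have p9 : 0 <= m * Y by exact: mulr_ge0.
have p10 : 0 <= m * H0 by exact: mulr_ge0.
have p11 : 0 <= k2 * H1 by exact: mulr_ge0.
have p12 : 0 <= c * Y by exact: mulr_ge0.
lra.
Qed.

(** [u] and [ut] are the solution and its time derivative at the midpoint, and [a] is the
    consistency error of the time difference. The two sup bounds concern the factors in [(th + eta +
    u)^2 / 2 - u^2 / 2 = th^2 / 2 + (eta + u) * th + (eta / 2 + u) * eta]. *)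
Definition energy_inequality (M K : R) : Prop :=
  forall (theta0 theta1 u ut eta a dU V : R -> R) (dt : R), 0 < dt ->
  let th := fun x => (theta0 x + theta1 x) / 2 in
  C1 theta0 -> C1 theta1 -> C1 u -> C1 eta -> continuous ut -> continuous a ->
  V = (fun x => th x + eta x + u x) ->
  dU = (fun x => dt^-1 * (theta1 x - theta0 x) + a x + ut x) ->
  I ut th = I (flux u) (derive1 th) ->
  I dU th = I (flux V) (derive1 th) ->
  (forall x : R, - L <= x <= L -> `|eta x + u x| <= M) ->
  (forall x : R, - L <= x <= L -> `|eta x / 2 + u x| <= M) ->
  Q theta1 - Q theta0 <= 2 * dt * (K * (Q th + Q a + Q eta + Q (derive1 eta))).

Lemma energy_step (M : R) : exists2 K : R, 0 < K & energy_inequality M K.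
Proof.
have [Cg Cg0 hCg] := garding L0 (divr_gt0 ltr01 (ltr0n R 4)).
pose kap := \int[@lebesgue_measure R]_(x in `[0, L]) kern x.
have kap0 : 0 <= kap by apply: kappa_ge0 => x _; exact: kern_ge0.
exists (1 + 4 * M ^+ 2 + 4 + `|Cg| + 4 * kap * (kap + 1)).
  have := sqr_ge0 M; have := normr_ge0 Cg; have : 0 <= 4 * kap * (kap + 1).
    by rewrite !mulr_ge0 // addr_ge0.
  by move: (4 * kap * (kap + 1)) (M ^+ 2) `|Cg| => ? ? ? ? ? ?; lra.
move=> theta0 theta1 u ut eta a dU V dt dt0 th c0 c1 cu ceta cut ca VE dUE wu wV b1 b2.
have cth : C1 th.
  apply: (@C1per_ext _ _ (fun x => 2^-1 * (theta0 x + theta1 x))).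
    by move=> x; rewrite mulrC.
  by apply: C1perZ; exact: C1perD.
have cdth := C1per_dcts cth; have cdeta := C1per_dcts ceta; have cdu := C1per_dcts cu.
have cth' := C1per_cts cth; have ceta' := C1per_cts ceta; have cu' := C1per_cts cu.
have cJth := nonlocalJ_cts cth; have cJeta := nonlocalJ_cts ceta.
have cFu := flux_cts cu.
have cJu := nonlocalJ_cts cu.
pose m1 x := eta x + u x; pose m2 x := eta x / 2 + u x.
have cm1 : continuous m1 by exact: ctsD.
have cm2 : continuous m2 by apply: ctsD => //; apply: ctsM => //; exact: cts_cst.
pose G1 x := m1 x * th x; pose G2 x := m2 x * eta x.
have cG1 : continuous G1 by exact: ctsM.
have cG2 : continuous G2 by exact: ctsM.
pose T x := th x ^+ 2 / 2.
have cT : continuous T by apply: ctsM; [exact: ctsX|exact: cts_cst].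
(* [th ^+ 2 / 2] is kept apart: its contribution [inner_cube] vanishes by periodicity, and
   the other quadratic terms carry a factor bounded by [M]. *)
have Vflux : flux V = fun x => T x + G1 x + G2 x - derive1 th x - derive1 eta x
    + nonlocalJ L th x + nonlocalJ L eta x + flux u x.
  apply/funext => x; rewrite VE /flux.
  have cte : C1 (fun x => th x + eta x) by exact: C1perD.
  have eJ := nonlocalJD x cte cu; have eJ' := nonlocalJD x cth ceta.
  have ed := congr1 (fun f => f x) (derive1D_fun cte cu).
  have ed' := congr1 (fun f => f x) (derive1D_fun cth ceta).
  have aux (t e w dt' de dw d d' jt je jw j j' : R) : j = j' + jw -> j' = jt + je ->
      d = d' + dw -> d' = dt' + de -> (t + e + w) ^+ 2 / 2 - d + j =
      t ^+ 2 / 2 + (e + w) * t + (e / 2 + w) * e - dt' - de + jt + je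
        + (w ^+ 2 / 2 - dw + jw).
    by move=> -> -> -> ->; field.
  exact: aux eJ eJ' ed ed'.
have eV : I (flux V) (derive1 th) = I T (derive1 th) + I G1 (derive1 th) + I G2 (derive1 th)
    - Q (derive1 th) - I (derive1 eta) (derive1 th) + I (nonlocalJ L th) (derive1 th)
    + I (nonlocalJ L eta) (derive1 th) + I (flux u) (derive1 th).
  rewrite Vflux.
  have k1 : continuous (fun x => T x + G1 x) by exact: ctsD.
  have k2 : continuous (fun x => T x + G1 x + G2 x) by exact: ctsD.
  have k3 : continuous (fun x => T x + G1 x + G2 x - derive1 th x) by apply: ctsD => //; exact: ctsN.
  have k4 : continuous (fun x => T x + G1 x + G2 x - derive1 th x - derive1 eta x).
    by apply: ctsD => //; exact: ctsN.
  have k5 : continuous (fun x => T x + G1 x + G2 x - derive1 th x - derive1 eta x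
     + nonlocalJ L th x) by exact: ctsD.
  have k6 : continuous (fun x => T x + G1 x + G2 x - derive1 th x - derive1 eta x
     + nonlocalJ L th x + nonlocalJ L eta x) by exact: ctsD.
  apply: (etrans (innerDl L k6 cFu cdth)); congr (_ + _).
  apply: (etrans (innerDl L k5 cJeta cdth)); congr (_ + _).
  apply: (etrans (innerDl L k4 cJth cdth)); congr (_ + _).
  apply: (etrans (innerBl L k3 cdeta cdth)); congr (_ - _).
  apply: (etrans (innerBl L k2 cdth cdth)); congr (_ - _).
  apply: (etrans (innerDl L k1 cG2 cdth)); congr (_ + _).
  exact: innerDl.
have dt0' : dt != 0 by rewrite gt_eqF.
(* Testing with the mean makes the cross terms of [(theta1 - theta0, theta0 + theta1)] cancel. *)
have edU : I dU th = (2 * dt)^-1 * (Q theta1 - Q theta0) + I a th + I ut th.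
  rewrite dUE.
  have cc0 := C1per_cts c0; have cc1 := C1per_cts c1.
  have k1 : continuous (fun x => theta1 x - theta0 x) by apply: ctsD => //; exact: ctsN.
  have k2 : continuous (fun x => dt^-1 * (theta1 x - theta0 x)) by apply: ctsM => //; exact: cts_cst.
  have k3 : continuous (fun x => dt^-1 * (theta1 x - theta0 x) + a x) by exact: ctsD.
  apply: (etrans (innerDl L k3 cut cth')); congr (_ + _).
  apply: (etrans (innerDl L k2 ca cth')); congr (_ + _).
  apply: (etrans (innerZl L dt^-1 k1 cth')).
  have thE : th = fun x => 2^-1 * (theta0 x + theta1 x) by apply/funext => x; rewrite /th mulrC.
  have e1 := innerBl L cc1 cc0 cth'.
  have k4 : continuous (fun x => theta0 x + theta1 x) by exact: ctsD.
  have e2 : I theta1 th = 2^-1 * (I theta1 theta0 + Q theta1).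
    rewrite thE; apply: (etrans (innerZr L 2^-1 k4 cc1)); congr (_ * _).
    exact: innerDr.
  have e3 : I theta0 th = 2^-1 * (Q theta0 + I theta1 theta0).
    rewrite thE; apply: (etrans (innerZr L 2^-1 k4 cc0)); congr (_ * _).
    by rewrite [I theta1 _]innerC; exact: innerDr.
  have aux (z p q q0 q1 c : R) : z = p - q -> p = 2^-1 * (c + q1) -> q = 2^-1 * (q0 + c) ->
      dt^-1 * z = (2 * dt)^-1 * (q1 - q0).
    by move=> -> -> ->; field.
  exact: aux e1 e2 e3.
have eT := inner_cube cth.
have q1 := inner_ge0 L th; have q2 := inner_ge0 L a; have q3 := inner_ge0 L eta.
have q4 := inner_ge0 L (derive1 eta); have q5 := inner_ge0 L (derive1 th).
have four : 0 < 4 :> R by [].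
have ba := inner_AMGM_norm L ltr01 ca cth'.
have bG1 := inner_AMGM_norm L four cG1 cdth.
have bG2 := inner_AMGM_norm L four cG2 cdth.
have bG1' : Q G1 <= M ^+ 2 * Q th by apply: innerM_le.
have bG2' : Q G2 <= M ^+ 2 * Q eta by apply: innerM_le.
have beta := inner_AMGM_norm L four cdeta cdth.
have bJ := hCg _ cth.
have kp : 0 < 4 * (kap + 1) by rewrite mulr_gt0 // ltr_wpDl.
have bJe := inner_kconv_le (kern_integrable L0) (fun x _ => kern_ge0 x) L0 kp cdeta
  (C1per_dper ceta) cdth.
have X : (2 * dt)^-1 * (Q theta1 - Q theta0) = - I a th + I G1 (derive1 th) + I G2 (derive1 th)
    - Q (derive1 th) - I (derive1 eta) (derive1 th) + I (nonlocalJ L th) (derive1 th)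
    + I (nonlocalJ L eta) (derive1 th).
  have aux (du v utth fu t x i g1 g2 p ie j1 j2 : R) : utth = fu -> du = v -> t = 0 ->
    v = t + g1 + g2 - p - ie + j1 + j2 + fu -> du = x + i + utth ->
    x = - i + g1 + g2 - p - ie + j1 + j2 by clear; lra.
  exact: aux wu wV eT eV edU.
have bG1'' : `|I G1 (derive1 th)| <= 4 * (M ^+ 2 * Q th) + (4 * 4)^-1 * Q (derive1 th).
  by apply: (le_trans bG1); rewrite lerD2r ler_pM2l.
have bG2'' : `|I G2 (derive1 th)| <= 4 * (M ^+ 2 * Q eta) + (4 * 4)^-1 * Q (derive1 th).
  by apply: (le_trans bG2); rewrite lerD2r ler_pM2l.
rewrite div1r in bJ.
have aux (d z b : R) : 0 < d -> (2 * d)^-1 * z <= b -> z <= 2 * d * b.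
  by clear => d0; rewrite mulrC ler_pdivrMr ?mulr_gt0 // [X in _ <= X]mulrC.
exact: (aux _ _ _ dt0 (energy_sum_bound q1 q2 q3 q4 q5 kap0 X ba bG1'' bG2'' beta bJ bJe erefl)).
Qed.

End Energy.

(** * Finite differences in time *)

Section Strip.
Variable R : realType.
Variable T : R.
Hypothesis T0 : 0 < T.

(* Composing with [clamp] extends a function continuous on the closed strip to the plane,
   so that one-sided continuity at the end times needs no separate treatment. *)
Definition clamp (t : R) : R := Num.max 0 (Num.min t T).

Lemma clamp_id t : 0 <= t <= T -> clamp t = t.
Proof. by case/andP=> t0 tT; rewrite /clamp min_l // max_r. Qed.

Lemma clamp_itv t : 0 <= clamp t <= T.
Proof. by rewrite /clamp le_max lexx /= ge_max ge_min lexx orbT andbT ltW. Qed.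

Lemma clamp_cts : continuous clamp.
Proof.
move=> t; apply: (@continuous_max _ _ (fun=> 0) (fun t => Num.min t T)).
  exact: cvg_cst.
by apply: (@continuous_min _ _ (fun t => t) (fun=> T)); [exact: cvg_id|exact: cvg_cst].
Qed.

Lemma strip_extension (f : R * R -> R) :
  {within [set p : R * R | 0 <= p.1 <= T], continuous f} ->
  continuous (fun p : R * R => f (clamp p.1, p.2)).
Proof.
move=> /subspace_continuousP cf p.
pose g (q : R * R) := (clamp q.1, q.2).
have cg : g q @[q --> p] --> g p.
  case: p => t x.
  have c1 : clamp q.1 @[q --> (t, x)] --> clamp t.
    by apply: cvg_comp; [exact: cvg_fst|exact: clamp_cts].
  have c2 : q.2 @[q --> (t, x)] --> x by exact: cvg_snd.
  exact: (cvg_pair c1 c2).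
have := cf (g p) (clamp_itv _); apply: cvg_trans.
move=> P hP.
have hP' : nbhs (g p) [set q : R * R | 0 <= q.1 <= T -> P (f q)] by case: (p) hP.
have h2 : nbhs p [set q | 0 <= (g q).1 <= T -> P (f (g q))] by exact: cg _ hP'.
have : nbhs p [set q | P (f (g q))].
  by apply: filterS h2 => q; apply; exact: clamp_itv.
by [].
Qed.

Lemma mvt_bound (f df : R -> R) (a b B : R) : a <= b -> continuous f ->
  (forall x : R, a < x < b -> is_derive x 1 f (df x)) ->
  (forall x : R, a <= x <= b -> `|df x| <= B) -> `|f b - f a| <= B * (b - a).
Proof.
move=> ab cf df' hB.
have h1 x : x \in `]a, b[ -> is_derive x 1 f (df x) by rewrite in_itv; exact: df'.
have [c cab ->] := MVT_segment ab h1 (continuous_subspaceT cf).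
rewrite normrM [`|b - a|]ger0_norm ?subr_ge0 // ler_wpM2r ?subr_ge0 //.
by apply: hB; move: cab; rewrite in_itv.
Qed.

Variable D : nat -> nat -> R -> R -> R.
Variable m : nat.
Hypothesis cD : forall i j, (i + j <= m)%N ->
  {within [set p : R * R | 0 <= p.1 <= T], continuous (fun p : R * R => D i j p.1 p.2)}.
Hypothesis Dt : forall i j, (i + j < m)%N -> forall t x : R, 0 < t < T ->
  is_derive t 1 (fun t' => D i j t' x) (D i.+1 j t x).
Hypothesis Dx : forall i j, (i + j < m)%N -> forall t x : R, 0 <= t <= T ->
  is_derive x 1 (D i j t) (D i j.+1 t x).

Lemma strip_cts_x i j t : (i + j <= m)%N -> 0 <= t <= T -> continuous (D i j t).
Proof.
move=> ij tT.
have c := strip_extension (cD ij).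
have -> : D i j t = (fun p : R * R => D i j (clamp p.1) p.2) \o (fun x => (t, x)).
  by apply/funext => x /=; rewrite clamp_id.
move=> x; apply: continuous_comp; last exact: c.
have c1 : (fun=> t) y @[y --> x] --> t by exact: cvg_cst.
have c2 : id y @[y --> x] --> x by exact: cvg_id.
exact: (cvg_pair c1 c2).
Qed.

Lemma strip_cts_t i j x : (i + j <= m)%N -> continuous (fun t => D i j (clamp t) x).
Proof.
move=> ij; have c := strip_extension (cD ij).
have -> : (fun t => D i j (clamp t) x) =
    (fun p : R * R => D i j (clamp p.1) p.2) \o (fun t => (t, x)) by [].
move=> t; apply: continuous_comp; last exact: c.
have c1 : id y @[y --> t] --> t by exact: cvg_id.
have c2 : (fun=> x) y @[y --> t] --> x by exact: cvg_cst.
exact: (cvg_pair c1 c2).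
Qed.

Lemma strip_derive_t i j (t x : R) : (i + j < m)%N -> 0 < t < T ->
  is_derive t 1 (fun t => D i j (clamp t) x) (D i.+1 j (clamp t) x).
Proof.
move=> ij tT; have := Dt ij x tT; rewrite clamp_id; last first.
  by case/andP: tT => /ltW -> /ltW ->.
apply: near_eq_is_derive.
have : `]0, T[%classic t by rewrite /= in_itv.
move/near_in_itvoo; apply: filterS => s; rewrite /= in_itv /= => /andP[s0 sT].
by rewrite clamp_id // !ltW.
Qed.

Lemma strip_bound (A : R) : exists2 M : R, 0 < M &
  forall i j, (i + j <= m)%N -> forall t x : R, 0 <= t <= T -> - A <= x <= A ->
    `|D i j t x| <= M.
Proof.
have h1 i j : exists M : R, (i + j <= m)%N -> forall t x : R,
    0 <= t <= T -> - A <= x <= A -> `|D i j t x| <= M.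
  have [ij|ij] := leqP (i + j) m; last by exists 0.
  have c := strip_extension (cD ij).
  pose f (p : R * R) := D i j (clamp p.1) p.2.
  have cK : compact (f @` (`[0, T] `*` `[- A, A])).
    apply: continuous_compact; first exact: continuous_subspaceT.
    by apply: compact_setX; exact: segment_compact.
  have [M [_ hM]] := compact_bounded cK.
  exists (M + 1) => _ t x tT xA; apply: (hM (M + 1)); first by rewrite ltrDl.
  by exists (t, x) => /=; [rewrite !in_itv|rewrite /f /= clamp_id].
have h2 i : exists F : nat -> R, forall j, (i + j <= m)%N -> forall t x : R,
    0 <= t <= T -> - A <= x <= A -> `|D i j t x| <= F j.
  by have [F hF] := choice (h1 i); exists F.
have [F hF] := choice h2.
(* The pairs with [i + j > m] carry arbitrary values of [F]; the absolute values keep them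
   harmless. *)
pose M := \sum_(i < m.+1) \sum_(j < m.+1) `|F i j|.
have M0 : 0 <= M by apply: sumr_ge0 => i _; apply: sumr_ge0.
exists (M + 1); first by rewrite ltr_wpDl.
move=> i j ij t x tT xA; apply: (le_trans (hF i j ij t x tT xA)).
have im : (i < m.+1)%N by rewrite ltnS; apply: leq_trans ij; exact: leq_addr.
have jm : (j < m.+1)%N by rewrite ltnS; apply: leq_trans ij; exact: leq_addl.
apply: (le_trans (ler_norm _)); apply: (@le_trans _ _ M); last by rewrite lerDl.
rewrite /M (bigD1 (Ordinal im)) //= (bigD1 (Ordinal jm)) //= -addrA lerDl addr_ge0 //.
  exact: sumr_ge0.
by apply: sumr_ge0 => k _; exact: sumr_ge0.
Qed.

(** * Centred differences around an interior time *)

Section TimeDifferences.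
Variables (x M : R).
Hypothesis hM : forall i j, (i + j <= m)%N -> forall t : R, 0 <= t <= T -> `|D i j t x| <= M.
Let E i j t := D i j (clamp t) x.

Let E_bound i j t : (i + j <= m)%N -> `|E i j t| <= M.
Proof. by move=> ij; apply: hM => //; exact: clamp_itv. Qed.

Lemma strip_lip i j (s t : R) : (i + j < m)%N -> 0 <= s -> s <= t -> t <= T ->
  `|D i j t x - D i j s x| <= M * (t - s).
Proof.
move=> ij s0 st tT.
have := @mvt_bound (E i j) (E i.+1 j) s t M st (@strip_cts_t i j x (ltnW ij)).
rewrite /E !clamp_id ?s0 ?(le_trans s0 st) ?(le_trans st tT) //; apply.
- move=> z /andP[sz zt]; apply: strip_derive_t => //.
  by rewrite (le_lt_trans s0 sz) (lt_le_trans zt tT).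
- by move=> z _; apply: E_bound.
Qed.

Variables t k : R.
Hypothesis k0 : 0 <= k.
Hypothesis tk1 : 0 <= t - k.
Hypothesis tk2 : t + k <= T.
Hypothesis tT : 0 < t < T.

(** Restricted to [s < k], since [t + k] may be the final time, where no derivative in time is
    given. The mean value theorem only asks for open intervals. *)
Lemma E_derive_fwd i j (s : R) : (i + j < m)%N -> 0 < s < k ->
  is_derive s 1 (fun s => E i j (t + s)) (E i.+1 j (t + s)).
Proof.
move=> ij /andP[s0 sk].
have h : is_derive (s + t) 1 (E i j) (E i.+1 j (s + t)).
  apply: strip_derive_t => //; case/andP: tT => ? ?.
  by apply/andP; split; move: tk1 tk2 => ? ?; lra.
rewrite [t + s]addrC.
have -> : (fun s => E i j (t + s)) = fun s => E i j (s + t).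
  by apply/funext => y; rewrite addrC.
exact: is_derive_comp_shift.
Qed.

Lemma E_derive_bwd i j (s : R) : (i + j < m)%N -> 0 < s < k ->
  is_derive s 1 (fun s => E i j (t - s)) (- E i.+1 j (t - s)).
Proof.
move=> ij /andP[s0 sk].
have h : is_derive (t - s) 1 (E i j) (E i.+1 j (t - s)).
  apply: strip_derive_t => //; case/andP: tT => ? ?.
  by apply/andP; split; move: tk1 tk2 => ? ?; lra.
have h1 : is_derive s 1 (fun s : R => t - s) (- 1).
  by rewrite -(sub0r 1); apply: is_deriveBf.
have := @is_derive1_comp _ (E i j) (fun s => t - s) s _ _ h h1.
by rewrite mulrN1.
Qed.

Lemma E_cts_fwd i j : (i + j <= m)%N -> continuous (fun s => E i j (t + s)).
Proof.
move=> ij; apply: (cts_comp (@strip_cts_t i j x ij)).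
by apply: ctsD; [exact: cts_cst|exact: cts_id].
Qed.

Lemma E_cts_bwd i j : (i + j <= m)%N -> continuous (fun s => E i j (t - s)).
Proof.
move=> ij; apply: (cts_comp (@strip_cts_t i j x ij)).
by apply: ctsD; [exact: cts_cst|apply: ctsN; exact: cts_id].
Qed.

Lemma E_diff1 i j (s : R) : (i + j < m)%N -> 0 <= s <= k ->
  `|E i j (t + s) - E i j (t - s)| <= 2 * M * s.
Proof.
move=> ij /andP[s0 sk].
have := @strip_lip i j (t - s) (t + s) ij.
rewrite /E !clamp_id; try by apply/andP; split; move: tk1 tk2 => ? ?; lra.
rewrite (_ : M * (t + s - (t - s)) = 2 * M * s); last by ring.
by apply; move: tk1 tk2 => ? ?; lra.
Qed.

(** In [s], the left side has derivative a symmetric first difference of the next time derivative,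
    of size [2 * M * s]; the mean value theorem gains the second factor [k]. *)
Lemma E_diff2 i j (s : R) : (i.+1 + j < m)%N -> 0 <= s <= k ->
  `|E i j (t + s) + E i j (t - s) - 2 * E i j t| <= 2 * M * k ^+ 2.
Proof.
rewrite addSn => ij /andP[s0 sk].
have ij' := ltnW ij.
pose p s := E i j (t + s) + E i j (t - s).
have cp : continuous p by apply: ctsD; [apply: E_cts_fwd|apply: E_cts_bwd]; exact: ltnW.
have := @mvt_bound p (fun s => E i.+1 j (t + s) - E i.+1 j (t - s)) 0 s (2 * M * k) s0 cp.
have -> : p s - p 0 = E i j (t + s) + E i j (t - s) - 2 * E i j t.
  by rewrite /p addr0 subr0; ring.
have M0 : 0 <= M by apply: le_trans (@E_bound i j t _); [exact: normr_ge0|exact: ltnW].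
move=> h; apply: le_trans (h _ _) _.
- move=> y /andP[y0 ys]; apply: is_deriveDf.
    by apply: E_derive_fwd => //; rewrite y0 (lt_le_trans ys sk).
  by apply: E_derive_bwd => //; rewrite y0 (lt_le_trans ys sk).
- move=> y /andP[y0 ys]; apply: le_trans (E_diff1 _ _) _.
  + by rewrite addSn.
  + by rewrite y0 (le_trans ys sk).
  + by apply: ler_wpM2l; [rewrite mulr_ge0|exact: le_trans ys sk].
- rewrite subr0 expr2 mulrA ler_wpM2l // !mulr_ge0 //.
Qed.

(** One more application of the same device: the derivative in [s] of the difference is the
    expression bounded in [E_diff2], one order higher in time. *)
Lemma E_diff3 i j : (i.+2 + j < m)%N ->
  `|E i j (t + k) - E i j (t - k) - 2 * k * E i.+1 j t| <= 2 * M * k ^+ 3.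
Proof.
move=> ij.
have ij2 : (i.+1 + j < m)%N by apply: ltn_trans ij; rewrite !addSn.
have ij1 : (i + j < m)%N by apply: ltn_trans ij2; rewrite !addSn.
pose p s := E i j (t + s) - E i j (t - s) - (2 * E i.+1 j t) * s.
have cp : continuous p.
  apply: ctsD; [apply: ctsD|apply: ctsN; apply: ctsM; [exact: cts_cst|exact: cts_id]].
    by apply: E_cts_fwd; exact: ltnW.
  by apply: ctsN; apply: E_cts_bwd; exact: ltnW.
have := @mvt_bound p (fun s => E i.+1 j (t + s) - - E i.+1 j (t - s) - (2 * E i.+1 j t) * 1)
  0 k (2 * M * k ^+ 2) k0 cp.
have -> : p k - p 0 = E i j (t + k) - E i j (t - k) - 2 * k * E i.+1 j t.
  by rewrite /p addr0 subr0 mulr0; ring.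
rewrite subr0 (_ : 2 * M * k ^+ 2 * k = 2 * M * k ^+ 3); last by ring.
apply.
- move=> y y0k; apply: is_deriveBf.
  by apply: is_deriveBf; [exact: E_derive_fwd|exact: E_derive_bwd].
- by move=> y y0k; rewrite opprK mulr1; apply: E_diff2.
Qed.

End TimeDifferences.

End Strip.

(** * The error recursion *)

Section Gronwall.
Variable R : realType.

(** The forcing [2 * s * e] is exactly what the shift by [e] turns into
    [(1 - s) * (y1 + e) <= (1 + s) * (y0 + e)]; and [1 + s <= (1 + 4 * s) * (1 - s)] amounts to
    [s <= 1 / 2] for positive [s]. *)
Lemma gronwall_step (y0 y1 s e : R) : 0 <= y0 -> 0 <= e -> 0 <= s <= 2^-1 ->
  y1 - y0 <= s * (y0 + y1) + 2 * s * e -> y1 + e <= (1 + 4 * s) * (y0 + e).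
Proof.
move=> y00 e0 /andP[s0 s1] h.
have z0 : 0 <= y0 + e by exact: addr_ge0.
have h1 : (y1 + e) * (1 - s) <= (y0 + e) * (1 + s) by lra.
have s2 : 0 < 1 - s by lra.
rewrite -(ler_pM2r s2); apply: (le_trans h1).
rewrite mulrAC [leLHS]mulrC ler_wpM2r //; nra.
Qed.

Lemma gronwall (y : nat -> R) (N : nat) (s e : R) : (forall n, 0 <= y n) -> 0 <= e ->
  0 <= s <= 2^-1 ->
  (forall n, (n < N)%N -> y n.+1 - y n <= s * (y n + y n.+1) + 2 * s * e) ->
  forall n, (n <= N)%N -> y n + e <= expR (n%:R * (4 * s)) * (y 0%N + e).
Proof.
move=> y0 e0 hs h; elim=> [_|n IH nN]; first by rewrite mul0r expR0 mul1r.
apply: (le_trans (gronwall_step (y0 n) e0 hs (h n nN))).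
have s0 : 0 <= 1 + 4 * s by case/andP: hs => s0 _; lra.
apply: (le_trans (ler_wpM2l s0 (IH (ltnW nN)))).
rewrite [leLHS]mulrA; apply: ler_wpM2r; first by rewrite addr_ge0.
have -> : n.+1%:R * (4 * s) = n%:R * (4 * s) + 4 * s by rewrite -natr1 mulrDl mul1r.
rewrite expRD mulrC; apply: ler_wpM2l.
  exact: expR_ge0.
exact: expR_ge1Dx.
Qed.

(** The arithmetic of the consistency estimates over plain reals: [l0] stands for [L] and [l] for
    the square of [M * k ^+ 2]. *)
Lemma time_error_sum_le (l0 p q z l : R) : p <= 2 * l0 * l -> q <= z ->
  2 * p + 2 * q <= 2 * z + 4 * l0 * l.
Proof. lra. Qed.

Lemma space_error_sum_le (l0 iq ip j i0 i1 z l : R) : iq <= 4 * l0 * l -> i0 <= z -> i1 <= z ->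
  j <= 2 * i0 + 2 * i1 -> ip = 2^-1 ^+ 2 * j -> 2 * iq + 2 * ip <= 2 * z + 8 * l0 * l.
Proof. lra. Qed.

Lemma quarter_sum_le (z b c : R) : z <= 2 * b + 2 * c -> 2^-1 ^+ 2 * z <= 2^-1 * (b + c).
Proof. lra. Qed.

Lemma energy_sum_le (l0 K q x y z w b l y0 y1 : R) : 0 < q -> 0 < K ->
  x <= 2^-1 * (y0 + y1) -> y <= 2 * b + 4 * l0 * l -> z + w <= 2 * b + 8 * l0 * l ->
  2 * q * (K * (x + y + z + w)) <= q * K * (y0 + y1) + 2 * (q * K) * (4 * b + 12 * l0 * l).
Proof.
move=> q0 K0 hx hy hz.
have -> : q * K * (y0 + y1) + 2 * (q * K) * (4 * b + 12 * l0 * l) =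
  2 * q * (K * (2^-1 * (y0 + y1) + (4 * b + 12 * l0 * l))) by field.
by rewrite !ler_pM2l ?mulr_gt0 //; lra.
Qed.

(** With [eta] the mean of [w0] and [w1] minus [v], the factors [eta + v] and [eta / 2 + v] of the
    nonlinear terms are convex combinations of [w0], [w1], [v], so a common bound passes to them. *)
Lemma mean_bound (w0 w1 v c : R) : - c <= w1 <= c -> - c <= w0 <= c ->
  - c <= (w0 + w1) / 2 - v + v <= c.
Proof. by move=> /andP[? ?] /andP[? ?]; apply/andP; split; lra. Qed.

Lemma half_mean_bound (w0 w1 v c : R) : - c <= v <= c -> - c <= w1 <= c -> - c <= w0 <= c ->
  - c <= ((w0 + w1) / 2 - v) / 2 + v <= c.
Proof. by move=> /andP[? ?] /andP[? ?] /andP[? ?]; apply/andP; split; lra. Qed.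

End Gronwall.

(** * Estimates of squared H^1 norms *)

Section Inner1Estimates.
Variable R : realType.
Variable L : R.
Hypothesis L0 : 0 < L.
Implicit Types f g : R -> R.
Local Notation C1 := (C1per L).

Lemma inner1_sup_le f (df : R -> R) (B : R) : (forall x : R, is_derive x 1 f (df x)) ->
  continuous df -> (forall x : R, - L <= x <= L -> `|f x| <= B) ->
  (forall x : R, - L <= x <= L -> `|df x| <= B) -> inner1 L f f <= 4 * L * B ^+ 2.
Proof.
move=> hf cdf b1 b2; rewrite /inner1 (derive1_fun hf).
have h1 := inner_sup_le L0 (cts_derive hf) b1.
have h2 := inner_sup_le L0 cdf b2.
have -> : 4 * L * B ^+ 2 = 2 * L * B ^+ 2 + 2 * L * B ^+ 2 by ring.
exact: lerD h1 h2.
Qed.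

Lemma inner1_add_le f g : C1 f -> C1 g ->
  inner1 L (fun x => f x + g x) (fun x => f x + g x) <= 2 * inner1 L f f + 2 * inner1 L g g.
Proof.
move=> cf cg; rewrite /inner1 (derive1D_fun cf cg).
have h1 := innerDD L (C1per_cts cf) (C1per_cts cg).
have h2 := innerDD L (C1per_dcts cf) (C1per_dcts cg).
have aux (a b c d x y : R) : x <= 2 * a + 2 * b -> y <= 2 * c + 2 * d ->
  x + y <= 2 * (a + c) + 2 * (b + d) by clear; lra.
exact: aux h1 h2.
Qed.

Lemma inner1_sub_le f g : C1 f -> C1 g ->
  inner1 L (fun x => f x - g x) (fun x => f x - g x) <= 2 * inner1 L f f + 2 * inner1 L g g.
Proof.
move=> cf cg; rewrite /inner1 (derive1B_fun cf cg).
have h1 := innerBB L (C1per_cts cf) (C1per_cts cg).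
have h2 := innerBB L (C1per_dcts cf) (C1per_dcts cg).
have aux (a b c d x y : R) : x <= 2 * a + 2 * b -> y <= 2 * c + 2 * d ->
  x + y <= 2 * (a + c) + 2 * (b + d) by clear; lra.
exact: aux h1 h2.
Qed.

Lemma inner1_scale c f : C1 f ->
  inner1 L (fun x => c * f x) (fun x => c * f x) = c ^+ 2 * inner1 L f f.
Proof.
move=> cf; rewrite (inner1Z c cf (C1perZ c cf)) (inner1C L f) (inner1Z c cf cf).
by rewrite mulrA.
Qed.

Lemma inner_le_inner1 f : inner L f f <= inner1 L f f.
Proof. by rewrite lerDl inner_ge0. Qed.

Lemma inner1_sup f x : C1 f -> - L <= x <= L ->
  f x ^+ 2 <= (1 + (2 * L)^-1) * inner1 L f f.
Proof. by move=> cf xL; exact: sobolev. Qed.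

End Inner1Estimates.

(** * The exact solution and its projections *)

Section Solution.
Variable R : realType.
Variables L T : R.
Hypotheses (L0 : 0 < L) (T0 : 0 < T).
Variable D : nat -> nat -> R -> R -> R.
Variable m : nat.
Hypothesis cD : forall i j, (i + j <= m)%N ->
  {within [set p : R * R | 0 <= p.1 <= T], continuous (fun p : R * R => D i j p.1 p.2)}.
Hypothesis Dt : forall i j, (i + j < m)%N -> forall t x : R, 0 < t < T ->
  is_derive t 1 (fun t' => D i j t' x) (D i.+1 j t x).
Hypothesis Dx : forall i j, (i + j < m)%N -> forall t x : R, 0 <= t <= T ->
  is_derive x 1 (D i j t) (D i j.+1 t x).
Hypothesis D_per : forall t : R, 0 <= t <= T -> per2L L (D 0%N 0%N t).

Lemma strip_per (t : R) j : (j <= m)%N -> 0 <= t <= T -> per2L L (D 0%N j t).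
Proof.
move=> + tT; elim: j => [_|j IH jm]; first exact: D_per.
by apply: (per2L_derive (IH (ltnW jm))) => x; exact: Dx.
Qed.

Lemma strip_C1per (t : R) j : (j < m)%N -> 0 <= t <= T -> C1per L (D 0%N j t).
Proof.
move=> jm tT; apply: (@C1perI _ _ _ (D 0%N j.+1 t)).
- exact: strip_per (ltnW jm) tT.
- by move=> x; exact: Dx.
- exact: (@strip_cts_x _ _ T0 _ _ cD 0%N j.+1).
Qed.

Lemma strip_derive1 (t : R) j : (j < m)%N -> 0 <= t <= T ->
  derive1 (D 0%N j t) = D 0%N j.+1 t.
Proof. by move=> jm tT; apply: derive1_fun => x; exact: Dx. Qed.

(** The nonlocal term is the kernel convolved with u_x, so its derivative is the kernel convolved
    with u_xx. The flux is therefore C^1 and can be integrated by parts. *)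
Lemma strip_flux (t : R) : (2 < m)%N -> 0 <= t <= T -> C1per L (flux L (D 0%N 0%N t)).
Proof.
move=> m2 tT; have m1 := ltnW m2; have m0 := ltnW m1.
pose v j := D 0%N j t.
have dv j (x : R) : (j < m)%N -> is_derive x 1 (v j) (v j.+1 x) by move=> jm; exact: Dx.
have c0 : C1per L (v 0%N) by exact: strip_C1per.
have c1 : C1per L (v 1%N) by exact: strip_C1per.
have c2 : C1per L (v 2%N) by exact: strip_C1per.
have p1 := C1per_per c1.
have -> : flux L (D 0%N 0%N t) = fun x => 2^-1 * (v 0%N x * v 0%N x) - v 1%N x
    + kconv 0 L (@kern R) (v 1%N) x.
  apply/funext => x; rewrite /flux nonlocalJE (strip_derive1 m0 tT) /v.
  by rewrite expr2 mulrC.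
have ik := kern_integrable L0.
apply: C1perD.
  by apply: C1perB; [apply: C1perZ; exact: C1perM|exact: c1].
apply: (@C1perI _ _ _ (kconv 0 L (@kern R) (v 2%N))).
- exact: kconv_per.
- exact: (kconv_is_derive ik (C1per_cts c2) (fun x => dv 1%N x m1)).
- exact: (kconv_cts ik (C1per_cts c2)).
Qed.

Lemma solution_weak u0 u (t : R) (phi : R -> R) : (2 < m)%N ->
  (forall t x : R, 0 <= t <= T -> D 0%N 0%N t x = u t x) ->
  periodic_solution L T u0 u -> 0 < t < T -> C1per L phi ->
  inner L (D 1%N 0%N t) phi = inner L (flux L (D 0%N 0%N t)) (derive1 phi).
Proof.
move=> m2 Du [? pde ?] tT cphi.
have tT' : 0 <= t <= T by case/andP: tT => /ltW -> /ltW ->.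
have ut : u t = D 0%N 0%N t by apply/funext => x; rewrite Du.
have cF := strip_flux m2 tT'.
have e : D 1%N 0%N t = fun x => - derive1 (flux L (D 0%N 0%N t)) x.
  apply/funext => x; apply/eqP; rewrite -addr_eq0 -{1}(_ : derive1 (fun t' => u t' x) t = D 1%N 0%N t x).
    by apply/eqP; move: (pde t x tT); rewrite ut; exact.
  (* [u] and [D 0 0] agree on the closed strip only, but [t] is interior, so they agree near [t] and
     have the same time derivative. *)
  apply: derive1_val; have := @Dt 0%N 0%N (ltnW (ltnW m2)) t x tT.
  apply: near_eq_is_derive.
  have : `]0, T[%classic t by rewrite /= in_itv.
  move/near_in_itvoo; apply: filterS => s; rewrite /= in_itv /= => /andP[s0 sT].
  by rewrite Du // !ltW.
have h := inner_by_parts L0 cF cphi.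
rewrite e.
apply: (etrans (innerNl L (C1per_dcts cF) (C1per_cts cphi))).
by rewrite h opprK.
Qed.

Variable M : R.
Hypothesis M0 : 0 < M.
Hypothesis hM : forall i j, (i + j <= m)%N -> forall t x : R, 0 <= t <= T -> - L <= x <= L ->
  `|D i j t x| <= M.

Variables (r n : nat) (g : 'I_n -> R -> R) (E : R).
Hypothesis rm : (r.+2 < m)%N.
Hypothesis cg : forall k, C1per L (g k).
Hypothesis hE : projection_rate L r g E.

Let jm j : (j <= r)%N -> (j < m)%N.
Proof. by move=> jr; apply: leq_ltn_trans jr _; exact: ltnW (ltnW rm). Qed.

Lemma strip_proj_error (t : R) W : 0 <= t <= T -> is_proj L g (D 0%N 0%N t) W ->
  inner1 L (fun x => D 0%N 0%N t x - W x) (fun x => D 0%N 0%N t x - W x) <= (E * M) ^+ 2.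
Proof.
move=> tT pW; apply: (@hE _ (fun j => D 0%N j t)) => //.
- exact: D_per.
- by move=> j jr x; apply: Dx => //; apply: jm; exact: ltnW.
- by move=> j jr; exact: (@strip_cts_x _ _ T0 _ _ cD 0%N j t (ltnW (jm jr)) tT).
- by move=> j jr x xL; apply: hM => //; exact: ltnW (jm jr).
Qed.

(** The difference quotient of the solution has its first [r] space derivatives bounded by [M], by
    the mean value theorem in time, and its projection is the difference quotient of the
    projections. *)
Lemma strip_proj_diff_error (s t : R) W0 W1 : 0 <= s -> s < t -> t <= T ->
  is_proj L g (D 0%N 0%N s) W0 -> is_proj L g (D 0%N 0%N t) W1 ->
  forall e, e = (fun x => (t - s)^-1 * (D 0%N 0%N t x - D 0%N 0%N s x)
    - (t - s)^-1 * (W1 x - W0 x)) ->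
  inner1 L e e <= (E * M) ^+ 2.
Proof.
move=> s0 st tT p0 p1; set c := (t - s)^-1.
have c0 : 0 < c by rewrite invr_gt0 subr_gt0.
have sT : 0 <= s <= T by rewrite s0 (le_trans (ltW st)).
have tT' : 0 <= t <= T by rewrite tT (le_trans s0 (ltW st)).
have m0 : (0 < m)%N by exact: jm.
have cs := strip_C1per m0 sT; have ct := strip_C1per m0 tT'.
move=> _ ->; refine (@hE (fun x => c * (D 0%N 0%N t x - D 0%N 0%N s x))
  (fun j x => c * (D 0%N j t x - D 0%N j s x)) M (fun x => c * (W1 x - W0 x)) M0 erefl _ _ _ _ _).
- by apply: C1per_per; apply: C1perZ; exact: C1perB.
- move=> j jr x; apply: is_deriveZf; apply: is_deriveBf.
    by apply: Dx => //; apply: jm; exact: ltnW.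
  by apply: Dx => //; apply: jm; exact: ltnW.
- move=> j jr; apply: ctsM; first exact: cts_cst.
  apply: ctsD; first exact: (@strip_cts_x _ _ T0 _ _ cD 0%N j t (ltnW (jm jr)) tT').
  by apply: ctsN; exact: (@strip_cts_x _ _ T0 _ _ cD 0%N j s (ltnW (jm jr)) sT).
- move=> j jr x xL; rewrite normrM gtr0_norm // /c mulrC ler_pdivrMr ?subr_gt0 //.
  apply: (@strip_lip _ _ T0 _ _ cD Dt x M _ 0%N j s t) => //; last exact: ltW.
  + by move=> i' j' ij t' t'T; exact: hM.
  + exact: jm.
- exact: proj_diff.
Qed.

(** [M] bounds the solution and the root bounds its projection error: compared with the competitor
    0, that error has squared H^1 norm at most [4 * L * M ^+ 2], and the Sobolev inequality turns
    this into a pointwise bound. *)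
Lemma strip_proj_sup (t : R) W (x : R) : 0 <= t <= T -> is_proj L g (D 0%N 0%N t) W -> - L <= x <= L ->
  `|W x| <= M + Num.sqrt ((1 + (2 * L)^-1) * (4 * L * M ^+ 2)).
Proof.
move=> tT pW xL; have m0 : (0 < m)%N by exact: jm.
pose v := D 0%N 0%N t.
have cv : C1per L v by exact: strip_C1per.
have cW := fspan_C1 cg pW.1.
have s0 : fspan g (fun=> 0).
  by exists (fun=> 0); apply/funext => y; rewrite big1 // => k _; rewrite mul0r.
have h1 := proj_best cg cv pW s0.
have ev : (fun y => v y - 0) = v by apply/funext => y; rewrite subr0.
rewrite ev in h1.
have h2 : inner1 L v v <= 4 * L * M ^+ 2.
  apply: (@inner1_sup_le _ _ L0 v (D 0%N 1%N t)).
  - by move=> y; exact: Dx.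
  - exact: (@strip_cts_x _ _ T0 _ _ cD 0%N 1%N t m0 tT).
  - by move=> y yL; apply: hM.
  - by move=> y yL; apply: hM.
have ce : C1per L (fun y => v y - W y) by exact: C1perB.
have h3 := inner1_sup L0 ce xL.
have k0 : 0 <= 1 + (2 * L)^-1 by rewrite addr_ge0 // invr_ge0 mulr_ge0 // ltW.
have h4 := le_trans h3 (ler_wpM2l k0 (le_trans h1 h2)).
have -> : W x = v x - (v x - W x) by ring.
apply: (le_trans (ler_normB _ _)); apply: lerD; first by apply: hM.
by rewrite -sqrtr_sqr ler_wsqrtr.
Qed.

(** * One time step, centred at [t] with half length [k] *)

Variables (t k : R) (W0 W1 : R -> R).
Hypotheses (k0 : 0 < k) (tk1 : 0 <= t - k) (tk2 : t + k <= T).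
Hypothesis p0 : is_proj L g (D 0%N 0%N (t - k)) W0.
Hypothesis p1 : is_proj L g (D 0%N 0%N (t + k)) W1.

Let tT : 0 < t < T.
Proof. by move: (k0) (tk1) (tk2) => ? ? ?; apply/andP; split; lra. Qed.

Let tT' : 0 <= t <= T.
Proof. by case/andP: tT => /ltW -> /ltW ->. Qed.

Let sT0 : 0 <= t - k <= T.
Proof. by move: (k0) (tk1) (tk2) => ? ? ?; apply/andP; split; lra. Qed.

Let sT1 : 0 <= t + k <= T.
Proof. by move: (k0) (tk1) (tk2) => ? ? ?; apply/andP; split; lra. Qed.

Let m2 : (2 < m)%N.
Proof. by apply: leq_ltn_trans rm; rewrite !ltnS. Qed.

Let m0 : (0 < m)%N. Proof. exact: ltnW (ltnW m2). Qed.

Let hMx (x : R) : - L <= x <= L ->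
  forall i j, (i + j <= m)%N -> forall t : R, 0 <= t <= T -> `|D i j t x| <= M.
Proof. by move=> xL i j ij s sT; exact: hM. Qed.

Let diff2 (x : R) j : - L <= x <= L -> (j.+1 < m)%N ->
  `|2^-1 * (D 0%N j (t + k) x + D 0%N j (t - k) x) - D 0%N j t x| <= M * k ^+ 2.
Proof.
move=> xL jm1.
have := @E_diff2 _ _ T0 _ _ cD Dt x M (hMx xL) t k (ltW k0) tk1 tk2 tT 0%N j k.
rewrite !clamp_id // lexx ltW // => /(_ jm1 isT).
move: (D 0%N j (t + k) x) (D 0%N j (t - k) x) (D 0%N j t x) => a b c h.
have -> : 2^-1 * (a + b) - c = 2^-1 * (a + b - 2 * c) by field.
rewrite normrM gtr0_norm ?invr_gt0 //.
apply: (@le_trans _ _ (2^-1 * (2 * M * k ^+ 2))); first by rewrite ler_pM2l ?invr_gt0.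
by rewrite !mulrA mulVf ?mul1r.
Qed.

Let diff3 (x : R) : - L <= x <= L ->
  `|(2 * k)^-1 * (D 0%N 0%N (t + k) x - D 0%N 0%N (t - k) x) - D 1%N 0%N t x| <= M * k ^+ 2.
Proof.
move=> xL.
have := @E_diff3 _ _ T0 _ _ cD Dt x M (hMx xL) t k (ltW k0) tk1 tk2 tT 0%N 0%N m2.
rewrite !clamp_id //.
move: (D 0%N 0%N (t + k) x) (D 0%N 0%N (t - k) x) (D 1%N 0%N t x) => a b c h.
have kn : k != 0 by rewrite gt_eqF.
have -> : (2 * k)^-1 * (a - b) - c = (2 * k)^-1 * (a - b - 2 * k * c) by field.
have k20 : 0 < (2 * k)^-1 by rewrite invr_gt0 mulr_gt0.
rewrite normrM gtr0_norm //.
apply: (@le_trans _ _ ((2 * k)^-1 * (2 * M * k ^+ 3))); first by rewrite ler_pM2l.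
by rewrite le_eqVlt; apply/orP; left; apply/eqP; field.
Qed.

(** [a] splits into the centred difference error [f] of the solution, of order [k ^+ 2], and the
    projection error [e] of its difference quotient. *)
Lemma consistency_time : let a := fun x => (2 * k)^-1 * (W1 x - W0 x) - D 1%N 0%N t x in
  continuous a /\ inner L a a <= 2 * (E * M) ^+ 2 + 4 * L * (M * k ^+ 2) ^+ 2.
Proof.
move=> a.
have cW0 := fspan_C1 cg p0.1; have cW1 := fspan_C1 cg p1.1.
have cv0 := strip_C1per m0 sT0; have cv1 := strip_C1per m0 sT1.
have cut : continuous (D 1%N 0%N t).
  exact: (@strip_cts_x _ _ T0 _ _ cD 1%N 0%N t m0 tT').
pose v0 := D 0%N 0%N (t - k); pose v1 := D 0%N 0%N (t + k); pose c := (2 * k)^-1.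
pose f x := c * (v1 x - v0 x) - D 1%N 0%N t x.
pose e x := c * (v1 x - v0 x) - c * (W1 x - W0 x).
have ce : C1per L e by exact: (C1perB (C1perZ c (C1perB cv1 cv0)) (C1perZ c (C1perB cW1 cW0))).
have cf : continuous f.
  apply: ctsD; last exact: ctsN.
  by apply: C1per_cts; apply: C1perZ; apply: C1perB; [exact: cv1|exact: cv0].
have -> : a = fun x => f x - e x by apply/funext => x; rewrite /a /f /e -/c; ring.
have ce' := C1per_cts ce.
split; first by apply: ctsD => //; exact: ctsN.
apply: (le_trans (innerBB L cf ce')).
have h1 : inner L f f <= 2 * L * (M * k ^+ 2) ^+ 2 by apply: (inner_sup_le L0 cf) => x; exact: diff3.
have h2 : inner1 L e e <= (E * M) ^+ 2.
  have st : t - k < t + k by rewrite ltrD2l -subr_gt0 opprK addr_gt0.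
  apply: (strip_proj_diff_error tk1 st tk2 p0 p1).
  by rewrite (_ : t + k - (t - k) = 2 * k) //; ring.
have h3 := le_trans (inner_le_inner1 L e) h2.
exact: (time_error_sum_le h1 h3).
Qed.

(** [eta] splits into the averaging error [q] of the solution, of order [k ^+ 2], and the mean [p]
    of two projection errors. The H^1 norm is bounded because [eta'] enters the energy
    inequality. *)
Lemma consistency_space : let eta := fun x => (W0 x + W1 x) / 2 - D 0%N 0%N t x in
  C1per L eta /\ inner1 L eta eta <= 2 * (E * M) ^+ 2 + 8 * L * (M * k ^+ 2) ^+ 2.
Proof.
move=> eta.
have cW0 := fspan_C1 cg p0.1; have cW1 := fspan_C1 cg p1.1.
have cv0 := strip_C1per m0 sT0; have cv1 := strip_C1per m0 sT1.
have cv := strip_C1per m0 tT'.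
pose v0 := D 0%N 0%N (t - k); pose v1 := D 0%N 0%N (t + k); pose v := D 0%N 0%N t.
pose q x := 2^-1 * (v1 x + v0 x) - v x.
pose dq x := 2^-1 * (D 0%N 1%N (t + k) x + D 0%N 1%N (t - k) x) - D 0%N 1%N t x.
pose e0 x := v0 x - W0 x; pose e1 x := v1 x - W1 x.
pose p x := 2^-1 * (e0 x + e1 x).
have ce0 : C1per L e0 by exact: (C1perB cv0 cW0).
have ce1 : C1per L e1 by exact: (C1perB cv1 cW1).
have ce : C1per L (fun x => e0 x + e1 x) by exact: C1perD.
have cp : C1per L p by exact: C1perZ.
have cq : C1per L q by exact: (C1perB (C1perZ 2^-1 (C1perD cv1 cv0)) cv).
have -> : eta = fun x => q x - p x.
  by apply/funext => x; rewrite /eta /q /p /e0 /e1 -/v0 -/v1 -/v; field.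
split; first exact: C1perB.
apply: (le_trans (inner1_sub_le cq cp)).
have hdq (x : R) : is_derive x 1 q (dq x).
  apply: is_deriveBf; last exact: Dx.
  by apply: is_deriveZf; apply: is_deriveDf; exact: Dx.
have c1 s : 0 <= s <= T -> continuous (D 0%N 1%N s).
  by move=> sT; exact: (@strip_cts_x _ _ T0 _ _ cD 0%N 1%N s m0 sT).
have cdq : continuous dq.
  apply: ctsD; last by apply: ctsN; exact: c1.
  by apply: ctsM; [exact: cts_cst|apply: ctsD; exact: c1].
have h1 : inner1 L q q <= 4 * L * (M * k ^+ 2) ^+ 2.
  apply: (inner1_sup_le L0 hdq cdq) => x xL; apply: diff2 => //; exact: ltnW m2.
have h2 := strip_proj_error sT0 p0; have h3 := strip_proj_error sT1 p1.
have h4 := inner1_add_le ce0 ce1.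
have h5 := inner1_scale (2^-1) ce.
exact: (space_error_sum_le h1 h2 h3 h4 h5).
Qed.

Let M2 := M + Num.sqrt ((1 + (2 * L)^-1) * (4 * L * M ^+ 2)).

Variable K : R.
Hypothesis K0 : 0 < K.
Hypothesis hK : energy_inequality L M2 K.

Variables (u0 : R -> R) (u : R -> R -> R).
Hypothesis Du : forall t x : R, 0 <= t <= T -> D 0%N 0%N t x = u t x.
Hypothesis pde : periodic_solution L T u0 u.
Variables U0 U1 : R -> R.
Hypotheses (sU0 : fspan g U0) (sU1 : fspan g U1).
Hypothesis scheme : forall chi, fspan g chi ->
  let V := fun x => (U0 x + U1 x) / 2 in
  inner L (fun x => (U1 x - U0 x) / (2 * k)) chi + inner L (V \* derive1 V) chi
  + inner L (derive1 V) (derive1 chi) - inner L (nonlocalJ L V) (derive1 chi) = 0.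

(** The energy inequality with step [2 * k], tested with [th], which lies in the finite element
    space. The mean's square is bounded by half the sum of the two squares, so the recursion has the
    shape required by [gronwall]. *)
Lemma error_step :
  forall theta0 theta1, theta0 = (fun x => U0 x - W0 x) -> theta1 = (fun x => U1 x - W1 x) ->
  inner L theta1 theta1 - inner L theta0 theta0 <=
    (2 * k * K) * (inner L theta0 theta0 + inner L theta1 theta1)
    + 2 * (2 * k * K) * (4 * (E * M) ^+ 2 + 12 * L * (M * k ^+ 2) ^+ 2).
Proof.
move=> _ _ -> ->; pose theta0 x := U0 x - W0 x; pose theta1 x := U1 x - W1 x.
rewrite -/theta0 -/theta1.
have cW0 := fspan_C1 cg p0.1; have cW1 := fspan_C1 cg p1.1.
have cU0 := fspan_C1 cg sU0; have cU1 := fspan_C1 cg sU1.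
have cv := strip_C1per m0 tT'.
have [ca ha] := consistency_time; have [ceta heta] := consistency_space.
set a := (fun x => _) in ca ha; set eta := (fun x => _) in ceta heta.
have c0 : C1per L theta0 by exact: C1perB.
have c1 : C1per L theta1 by exact: C1perB.
pose v := D 0%N 0%N t.
pose th x := (theta0 x + theta1 x) / 2.
have s0 : fspan g (fun x => U0 x + (-1) * W0 x) by exact: fspan_comb p0.1.
have s1 : fspan g (fun x => U1 x + (-1) * W1 x) by exact: fspan_comb p1.1.
have thE : th = fun x => 2^-1 * (theta0 x + theta1 x) by apply/funext => x; rewrite /th mulrC.
have cth : C1per L th by rewrite thE; apply: C1perZ; exact: C1perD.
have sth : fspan g th.
  have z : fspan g (fun=> 0).
    by exists (fun=> 0); apply/funext => y; rewrite big1 // => j _; rewrite mul0r.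
  have := fspan_comb 2^-1 z (fspan_comb 1 s0 s1); congr (fspan g _).
  by apply/funext => x; rewrite /th /theta0 /theta1; field.
pose V x := (U0 x + U1 x) / 2.
have cV : C1per L V.
  by apply: (C1per_ext _ (C1perZ 2^-1 (C1perD cU0 cU1))) => x; rewrite /V mulrC.
have wU := flux_weak L0 cV cth (scheme sth).
have wv := solution_weak m2 Du pde tT cth.
have cut : continuous (D 1%N 0%N t).
  exact: (@strip_cts_x _ _ T0 _ _ cD 1%N 0%N t m0 tT').
have VE : V = fun x => th x + eta x + v x.
  by apply/funext => x; rewrite /V /th /eta /theta0 /theta1 -/(v x); field.
have kn : k != 0 by rewrite gt_eqF.
have dUE : (fun x => (U1 x - U0 x) / (2 * k)) =
    fun x => (2 * k)^-1 * (theta1 x - theta0 x) + a x + D 1%N 0%N t x.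
  by apply/funext => x; rewrite /a /theta0 /theta1; field.
have sup0 (x : R) (xL : - L <= x <= L) := strip_proj_sup sT0 p0 xL.
have sup1 (x : R) (xL : - L <= x <= L) := strip_proj_sup sT1 p1 xL.
have M2M : M <= M2 by rewrite lerDl sqrtr_ge0.
have b1 (x : R) : - L <= x <= L -> `|eta x + v x| <= M2.
  move=> xL; have := sup0 x xL; have := sup1 x xL; rewrite -/M2 !ler_norml.
  by rewrite /eta -/(v x); exact: mean_bound.
have b2 (x : R) : - L <= x <= L -> `|eta x / 2 + v x| <= M2.
  move=> xL; have := sup0 x xL; have := sup1 x xL.
  have h0 : `|v x| <= M2 by apply: le_trans M2M; apply: hM.
  move: h0; rewrite -/M2 !ler_norml.
  by rewrite /eta -/(v x); exact: half_mean_bound.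
have k20 : 0 < 2 * k by rewrite mulr_gt0.
have h := hK k20 c0 c1 cv ceta cut ca VE dUE wv wU b1 b2.
apply: (le_trans h).
have cs : continuous (fun x => theta0 x + theta1 x) by exact: ctsD (C1per_cts c0) (C1per_cts c1).
have hth : inner L th th <= 2^-1 * (inner L theta0 theta0 + inner L theta1 theta1).
  rewrite thE (innerZZ L 2^-1 cs).
  exact: quarter_sum_le (innerDD L (C1per_cts c0) (C1per_cts c1)).
exact: (energy_sum_le k20 K0 hth ha heta).
Qed.

End Solution.

(** [y] and [y0] are the squared norms of theta at the current and initial times, [X] the Gronwall
    factor, [H] the power of the mesh size and [d] the time step. The coefficient 6 collects 2 from
    projecting the initial datum and 4 from the forcing [e]. *)
Lemma total_error_le (R : realType) (Qr Qs y y0 e X A L M C0 d H : R) :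
  0 <= L -> 0 <= d -> 0 <= H -> 0 <= X -> 0 <= y0 -> 0 <= e ->
  Qr <= 2 * y + 2 * (A * H * M) ^+ 2 -> y + e <= X * (y0 + e) ->
  y0 <= 2 * Qs + 2 * (A * H * M) ^+ 2 -> Qs <= (C0 * H) ^+ 2 ->
  e = 4 * (A * H * M) ^+ 2 + 12 * L * (M * (d / 2) ^+ 2) ^+ 2 ->
  Qr <= (2 * X * (2 * C0 ^+ 2 + 6 * (A * M) ^+ 2 + 12 * L * M ^+ 2) + 2 * (A * M) ^+ 2)
        * (d ^+ 2 + H) ^+ 2.
Proof.
move=> L0 d0 H0 X0 y00 e0 h1 h2 h3 h4 he.
have d2 : 0 <= d ^+ 2 by exact: sqr_ge0.
set s := (d ^+ 2 + H) ^+ 2.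
have s0 : 0 <= s by exact: sqr_ge0.
have Hs : H ^+ 2 <= s by rewrite /s lerXn2r ?nnegrE ?addr_ge0 // lerDr.
have ds : (d ^+ 2) ^+ 2 <= s by rewrite /s lerXn2r ?nnegrE ?addr_ge0 // lerDl.
have a1 : (A * H * M) ^+ 2 <= (A * M) ^+ 2 * s.
  have -> : (A * H * M) ^+ 2 = (A * M) ^+ 2 * H ^+ 2 by ring.
  by rewrite ler_wpM2l ?sqr_ge0.
have a2 : (C0 * H) ^+ 2 <= C0 ^+ 2 * s by rewrite exprMn ler_wpM2l ?sqr_ge0.
have a3 : L * (M * (d / 2) ^+ 2) ^+ 2 <= L * M ^+ 2 * s.
  have -> : L * (M * (d / 2) ^+ 2) ^+ 2 = L * M ^+ 2 * ((d ^+ 2) ^+ 2 / 16) by field.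
  apply: ler_wpM2l; first by apply: mulr_ge0 => //; exact: sqr_ge0.
  have := sqr_ge0 (d ^+ 2); lra.
move: a1 a2 a3 h1 h3 h4 he.
move: ((A * H * M) ^+ 2) ((A * M) ^+ 2) ((C0 * H) ^+ 2) (C0 ^+ 2) (M * (d / 2) ^+ 2) (M ^+ 2).
move=> p q c c2 l m a1 a2 a3 h1 h3 h4 he.
have b1 : y0 + e <= (2 * c2 + 6 * q + 12 * L * m) * s by clear -h3 h4 he a1 a2 a3; lra.
have b2 := le_trans h2 (ler_wpM2l X0 b1).
have -> : (2 * X * (2 * c2 + 6 * q + 12 * L * m) + 2 * q) * s =
  2 * (X * ((2 * c2 + 6 * q + 12 * L * m) * s)) + 2 * (q * s) by ring.
move: (X * _) b2 => z b2; clear -b2 h1 a1 e0; lra.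
Qed.

Theorem theorem4p5 (R : realType) (r : nat) (hr : (2 <= r)%N) :
  exists m : nat,
  forall (L T : R), 0 < L -> 0 < T ->
  forall (I : Type) (S : I -> fe_space L r), approximation_property S ->
  forall (u0 : R -> R) (u : R -> R -> R),
    per2L L u0 ->
    periodic_solution L T u0 u ->
    smooth_strip m T u ->
  forall (C0 : R) (uh0 : I -> R -> R),
    (forall i, fe_set (S i) (uh0 i)) ->
    (forall i, L2norm L (uh0 i \- u0) <= C0 * mesh (S i) ^+ r.-1) ->
  exists delta C : R, [/\ 0 < delta, 0 < C &
    forall (i : I) (N : nat) (U : nat -> R -> R),
      (0 < N)%N ->
      T / N%:R < delta ->
      (forall n, (n <= N)%N -> fe_set (S i) (U n)) ->
      U 0%N = uh0 i ->
      crank_nicolson (S i) (T / N%:R) N U ->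
      \big[Num.max/0]_(n < N.+1)
          L2norm L (u (n%:R * (T / N%:R)) \- U n)
        <= C * ((T / N%:R) ^+ 2 + mesh (S i) ^+ r.-1)].
Proof.
(* The projection of difference quotients takes [r] space derivatives together with one in time, the
   consistency estimates take three derivatives; [r.+3] covers both. *)
exists r.+3 => L T L0 T0 I S AP u0 u pu0 pde [D [Du cD Dt Dx]] C0 uh0 suh0 huh0.
have r1 : (1 <= r)%N by exact: ltnW hr.
have [up _ uu0] := pde.
have D_per t : 0 <= t <= T -> per2L L (D 0%N 0%N t).
  by move=> tT x; rewrite !Du //; exact: up.
have [Ca Ca0 hCa] := projection_error L0 r1 AP.
have [M M0 hM] := strip_bound T0 cD L.
have [K K0 hK] := energy_step L0 (M + Num.sqrt ((1 + (2 * L)^-1) * (4 * L * M ^+ 2))).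
(* The Gronwall factor at the final time, where [n * (4 * dt * K)] is at most [4 * K * T]. *)
pose X := expR (4 * K * T).
pose B := 2 * X * (2 * C0 ^+ 2 + 6 * (Ca * M) ^+ 2 + 12 * L * M ^+ 2) + 2 * (Ca * M) ^+ 2.
have X0 : 0 <= X by exact: expR_ge0.
have B0 : 0 <= B.
  apply: addr_ge0; last by rewrite mulr_ge0 // sqr_ge0.
  apply: mulr_ge0; first exact: mulr_ge0.
  have p1 := sqr_ge0 C0; have p2 := sqr_ge0 (Ca * M).
  have p3 : 0 <= L * M ^+ 2 by apply: mulr_ge0; [exact: ltW|exact: sqr_ge0].
  by clear -p1 p2 p3; lra.
(* [delta] makes [dt * K <= 1 / 2], as the Gronwall lemma demands. [B] bounds the squared error, and
   [B <= (1 + B) ^+ 2] gives a positive constant without a square root. *)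
exists (2 * K)^-1, (1 + B); split; first by rewrite invr_gt0 mulr_gt0.
  by rewrite ltr_wpDr.
move=> i N U N0 hdt sU U00 scheme.
set dt := T / N%:R in hdt scheme *; set H := mesh (S i) ^+ r.-1.
have H0 : 0 <= H by rewrite exprn_ge0 // ltW // mesh_gt0.
have N0' : 0 < N%:R :> R by rewrite ltr0n.
have dt0 : 0 < dt by rewrite divr_gt0.
have tN n : (n <= N)%N -> 0 <= n%:R * dt <= T.
  move=> nN; rewrite mulr_ge0 ?ler0n ?(ltW dt0) //=.
  by rewrite /dt mulrA ler_pdivrMr // mulrC ler_pM2l // ler_nat.
pose g := @fe_gen R L r (S i).
have cg k : C1per L (g k) by exact: fe_C1.
have hE : projection_rate L r g (Ca * H) := hCa i.
have [W hW] : exists W : nat -> R -> R, forall n, (n <= N)%N ->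
    is_proj L g (D 0%N 0%N (n%:R * dt)) (W n).
  (* A total sequence is chosen, with the default 0 beyond [N], where [n * dt] leaves the time
     interval. *)
  have h n : exists W : R -> R, (n <= N)%N -> is_proj L g (D 0%N 0%N (n%:R * dt)) W.
    have [nN|nN] := leqP n N; last by exists (fun=> 0).
    have cv := strip_C1per T0 cD Dx D_per (isT : (0 < r.+3)%N) (tN n nN).
    by have [W pW] := proj_exists cg cv; exists W.
  by have [W hW] := choice h; exists W.
pose y n := inner L (fun x => U n x - W n x) (fun x => U n x - W n x).
pose e := 4 * (Ca * H * M) ^+ 2 + 12 * L * (M * (dt / 2) ^+ 2) ^+ 2.
have e0 : 0 <= e.
  apply: addr_ge0; apply: mulr_ge0; rewrite ?sqr_ge0 //.
  by apply: mulr_ge0 => //; exact: ltW.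
have k2 : 2 * (dt / 2) = dt by rewrite mulrCA divff ?mulr1 // pnatr_eq0.
have step n : (n < N)%N -> y n.+1 - y n <= dt * K * (y n + y n.+1) + 2 * (dt * K) * e.
  move=> nN.
  have t0 : n%:R * dt + dt / 2 - dt / 2 = n%:R * dt by rewrite addrK.
  have t1 : n%:R * dt + dt / 2 + dt / 2 = n.+1%:R * dt.
    by rewrite -[in RHS]natr1 mulrDl mul1r -addrA -splitr.
  have k0 : 0 < dt / 2 by rewrite divr_gt0.
  have tk1 : 0 <= n%:R * dt + dt / 2 - dt / 2.
    by rewrite t0; case/andP: (tN n (ltnW nN)).
  have tk2 : n%:R * dt + dt / 2 + dt / 2 <= T.
    by rewrite t1; case/andP: (tN n.+1 nN).
  have p0 : is_proj L g (D 0%N 0%N (n%:R * dt + dt / 2 - dt / 2)) (W n).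
    by rewrite t0; exact: hW (ltnW nN).
  have p1 : is_proj L g (D 0%N 0%N (n%:R * dt + dt / 2 + dt / 2)) (W n.+1).
    by rewrite t1; exact: hW nN.
  have sch chi : fspan g chi ->
    let V := fun x => (U n x + U n.+1 x) / 2 in
    inner L (fun x => (U n.+1 x - U n x) / (2 * (dt / 2))) chi + inner L (V \* derive1 V) chi
    + inner L (derive1 V) (derive1 chi) - inner L (nonlocalJ L V) (derive1 chi) = 0.
    by move=> schi; rewrite k2; exact: scheme nN chi schi.
  have := error_step L0 T0 cD Dt Dx D_per M0 hM (ltnSn r.+2) cg hE k0 tk1 tk2 p0 p1 K0 hK
    Du pde (sU n (ltnW nN)) (sU n.+1 nN) sch erefl erefl.
  by rewrite k2.
have hs : 0 <= dt * K <= 2^-1.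
  rewrite mulr_ge0 ?(ltW dt0) ?(ltW K0) //=.
  apply: (le_trans (ler_wpM2r (ltW K0) (ltW hdt))).
  by rewrite invfM -mulrA mulVf ?mulr1 // gt_eqF.
have y0 n : 0 <= y n by exact: inner_ge0.
have gr := gronwall y0 e0 hs step.
have err n : (n <= N)%N -> inner1 L (fun x => D 0%N 0%N (n%:R * dt) x - W n x)
    (fun x => D 0%N 0%N (n%:R * dt) x - W n x) <= (Ca * H * M) ^+ 2.
  by move=> nN; exact: (strip_proj_error T0 cD Dx D_per M0 hM (ltnSn r.+2) hE (tN n nN) (hW n nN)).
have cts_err n : (n <= N)%N ->
    continuous (fun x => U n x - W n x) /\ continuous (fun x => D 0%N 0%N (n%:R * dt) x - W n x).
  move=> nN; have cW := fspan_C1 cg (hW n nN).1; have cU := fspan_C1 cg (sU n nN).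
  have cv := strip_C1per T0 cD Dx D_per (isT : (0 < r.+3)%N) (tN n nN).
  by split; apply: C1per_cts; [exact: (C1perB cU cW)|exact: (C1perB cv cW)].
have u0E : D 0%N 0%N (0%N%:R * dt) = u0.
  by apply/funext => x; rewrite mul0r Du ?uu0 // lexx ltW.
have cu0 : C1per L u0.
  by have := strip_C1per T0 cD Dx D_per (isT : (0 < r.+3)%N) (tN 0%N (leq0n N)); rewrite u0E.
have y0b : y 0%N <= 2 * inner L (uh0 i \- u0) (uh0 i \- u0) + 2 * (Ca * H * M) ^+ 2.
  have [_ cr] := cts_err 0%N (leq0n N).
  have cuh : C1per L (uh0 i) := fspan_C1 cg (suh0 i).
  have cd : continuous (uh0 i \- u0) := C1per_cts (C1perB cuh cu0).
  (* The initial theta is the error of the initial approximation plus the projection error of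
     [u0]. *)
  have eq0 : (fun x => U 0%N x - W 0%N x) =
      fun x => (uh0 i \- u0) x + (D 0%N 0%N (0%N%:R * dt) x - W 0%N x).
    by apply/funext => x; rewrite u0E U00 /=; ring.
  rewrite /y eq0; apply: (le_trans (innerDD L cd cr)).
  by rewrite lerD2l ler_pM2l //; exact: le_trans (inner_le_inner1 _ _) (err 0%N (leq0n N)).
have uh0b : inner L (uh0 i \- u0) (uh0 i \- u0) <= (C0 * H) ^+ 2.
  by apply: L2norm_leP (huh0 i); exact: le_trans (L2norm_ge0 _ _) (huh0 i).
have C1 : 0 <= 1 + B by rewrite addr_ge0.
have rhs0 : 0 <= dt ^+ 2 + H by rewrite addr_ge0 // sqr_ge0.
(* The maximum starts from the default value 0, so the right side must also be shown nonnegative. *)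
apply: bigmax_le => [|[n nN] _]; first exact: mulr_ge0.
rewrite /=; rewrite ltnS in nN.
have [cth cr] := cts_err n nN.
pose v := D 0%N 0%N (n%:R * dt).
have fE : u (n%:R * dt) \- U n = fun x => (v x - W n x) - (U n x - W n x).
  by apply/funext => x; rewrite /= -Du ?tN // -/v; ring.
have h1 : inner L (u (n%:R * dt) \- U n) (u (n%:R * dt) \- U n) <=
    2 * y n + 2 * (Ca * H * M) ^+ 2.
  rewrite fE; apply: (le_trans (innerBB L cr cth)); rewrite addrC lerD2l ler_pM2l //.
  exact: le_trans (inner_le_inner1 _ _) (err n nN).
have h2 : y n + e <= X * (y 0%N + e).
  apply: (le_trans (gr n nN)); apply: ler_wpM2r; first by rewrite addr_ge0.
  rewrite /X ler_expR.
  have -> : n%:R * (4 * (dt * K)) = 4 * K * (n%:R * dt) by ring.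
  by rewrite ler_pM2l ?mulr_gt0 //; case/andP: (tN n nN).
have h3 := total_error_le (ltW L0) (ltW dt0) H0 X0 (y0 0%N) e0 h1 h2 y0b uh0b erefl.
have c0 : 0 <= (1 + B) * (dt ^+ 2 + H) by exact: mulr_ge0.
rewrite -(ger0_norm c0) -sqrtr_sqr ler_wsqrtr //.
apply: (le_trans h3); rewrite (exprMn _ (1 + B)) -/B.
by apply: ler_wpM2r; [exact: sqr_ge0|clear -B0; nra].
Qed.
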